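(* Let $n\ge4$ and $r\in\mathbb{R}$, and let $\nabla$ be the $\mathrm{SU}(n+1)$-invariant metric affine connection with totally skew-symmetric torsion on $\mathbb{S}^{2n+1}$ given by $$\nabla_XY=\nabla^g_XY+r\big(\Phi(X,Y)\,\xi-\eta(X)\psi(Y)+\eta(Y)\psi(X)\big).$$ Then $$\mathrm{Sym}(\mathrm{Ric}^\nabla)=2(n-r^2)\,g-2(n-1)r^2\,\eta\otimes\eta,\qquad s^\nabla=2n(2n+1)-6nr^2.$$ In particular, for $n\ge4$, $(\mathbb{S}^{2n+1},g,\nabla)$ is not $\nabla$-Einstein for any $\mathrm{SU}(n+1)$-invariant metric affine connection $\nabla$ unless $\nabla=\nabla^g$.
   Context: $\mathrm{SU}(n+1)$ acts on the unit sphere $\mathbb{S}^{2n+1}\subset\mathbb{C}^{n+1}$ by matrix multiplication; write $\tau_\sigma(p)=\sigma p$. For a vector field $X$, $\tau_\sigma(X)_p=(\tau_\sigma)_*(X_{\sigma^{-1}p})$. An affine connection $\nabla$ is $\mathrm{SU}(n+1)$-invariant if $\tau_\sigma(\nabla_XY)=\nabla_{\tau_\sigma(X)}\tau_\sigma(Y)$ for all $\sigma$ and all vector fields $X,Y$. $g$ is the canonical Riemannian metric of constant sectional curvature $1$ and $\nabla^g$ its Levi-Civita connection. $\nabla$ is metric if $\nabla g=0$ (its torsion need not vanish). Its torsion is $T^\nabla(X,Y)=\nabla_XY-\nabla_YX-[X,Y]$, and $\nabla$ has totally skew-symmetric torsion if $\omega_\nabla(X,Y,Z)=g(T^\nabla(X,Y),Z)$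 is a $3$-form. Sasakian structure: $\xi_z=-\mathbf{i}z$; with $N$ the unit outward normal, $\psi,\eta$ are determined by the decomposition $\mathbf{i}X=\psi(X)+\eta(X)N$ into tangent and normal parts; $\Phi(X,Y)=g(X,\psi(Y))$. Curvature: $R^\nabla(X,Y)Z=\nabla_X\nabla_YZ-\nabla_Y\nabla_XZ-\nabla_{[X,Y]}Z$, $\mathrm{Ric}^\nabla(Y,Z)=\mathrm{tr}(X\mapsto R^\nabla(X,Y)Z)$, $s^\nabla$ is the $g$-trace of $\mathrm{Ric}^\nabla$, and $\mathrm{Sym}$ denotes the symmetric part. $(M,g,\nabla)$ is $\nabla$-Einstein if $\nabla$ is metric, has totally skew-symmetric torsion and $\mathrm{Sym}(\mathrm{Ric}^\nabla)=\frac{s^\nabla}{\dim M}g$. *)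

(* Defs.v *)
From HB Require Import structures.
From mathcomp Require Import all_boot all_order all_algebra spectral.
From mathcomp Require Import complex.
From mathcomp Require Import boolp classical_sets reals topology normedtype derive.

Set Implicit Arguments.
Unset Strict Implicit.
Unset Printing Implicit Defensive.
Import Order.TTheory GRing.Theory Num.Theory.
Import numFieldNormedType.Exports.

Local Open Scope classical_set_scope.
Local Open Scope ring_scope.

(* C^{n+1} as a real vector space: z = x + i y is stored as the real column
   vector (x, y) of height (n+1) + (n+1). *)
Notation Cspace R n := 'cV[R%type]_(n.+1 + n.+1).

Section Ambient.
Variables (R : realType) (n : nat).
Local Notation E := (Cspace R n).

Definition toC (p : E) : 'cV[R[i]]_n.+1 :=
  \col_k (usubmx p k 0 +i* dsubmx p k 0)%C.

Definition ofC (z : 'cV[R[i]]_n.+1) : E :=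
  col_mx (map_mx (@complex.Re R) z) (map_mx (@complex.Im R) z).

Definition mul_i (p : E) : E := ofC ('i%C *: toC p).

Definition dot (u v : E) : R := (u^T *m v) 0 0.

Definition enorm (u : E) : R := Num.sqrt (dot u u).

End Ambient.

Definition sphere (R : realType) (n : nat) : Type :=
  {p : Cspace R n | dot p p == 1}.

Notation sfield R n := (sphere R n -> Cspace R n).

Section Smooth.
Variables (R : realType) (n : nat).
Local Notation E := (Cspace R n).
Local Notation S := (sphere R n).

Fact base_point_subproof :
  dot (delta_mx ord0 0 : E) (delta_mx ord0 0) == 1.
Proof. by rewrite /dot trmx_delta mul_delta_mx !mxE !eqxx. Qed.

Definition base_point : S := exist (fun p : E => dot p p == 1) _ base_point_subproof.

(* x |-> x / |x|; the value at x = 0 is irrelevant. *)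
Definition radial (x : E) : S := insubd base_point ((enorm x)^-1 *: x).

Definition extend (W : Type) (f : S -> W) : E -> W := fun x => f (radial x).

Section Maps.
Variable W : normedModType R.

Fixpoint Ck_on (k : nat) (U : set E) (F : E -> W) : Prop :=
  (forall x, U x -> {for x, continuous F}) /\
  if k is k'.+1 then
    forall v : E, (forall x, U x -> derivable F x v) /\
                  Ck_on k' U (fun x => 'D_v F x)
  else True.

(* The retraction x |-> x / |x| of C^{n+1} \ {0} onto the sphere is a smooth
   submersion, so f is smooth on the sphere exactly when f(x / |x|) is smooth
   on C^{n+1} \ {0}, and the derivative of f along a tangent vector v at p is
   the directional derivative of f(x / |x|). *)
Definition smooth (f : S -> W) : Prop :=
  forall k, Ck_on k [set x | x != 0] (extend f).

Definition along (X : sfield R n) (f : S -> W) : S -> W :=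
  fun p => 'D_(X p) (extend f) (val p).

End Maps.

Definition smooth_fun (f : S -> R) : Prop := smooth (f : S -> R^o).

Definition derivation (X : sfield R n) (f : S -> R) : S -> R :=
  along X (f : S -> R^o).

End Smooth.

Section Geometry.
Variables (R : realType) (n : nat).
Local Notation E := (Cspace R n).
Local Notation S := (sphere R n).
Local Notation F := (sfield R n).

Definition tangent (p : S) : {vspace E} :=
  lker (linfun (mulmx (val p)^T : E -> 'M[R]_1)).

(* Elements of F are arbitrary maps S -> E; a vector field is one that is
   smooth and tangent. *)
Definition vector_field (X : F) : Prop :=
  smooth X /\ forall p, X p \in tangent p.

Definition addf (X Y : F) : F := fun p => X p + Y p.
Definition subf (X Y : F) : F := fun p => X p - Y p.
Definition scalef (f : S -> R) (X : F) : F := fun p => f p *: X p.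

Definition metric (X Y : F) : S -> R := fun p => dot (X p) (Y p).

(* [X, Y] computed componentwise in the ambient coordinates, i.e.
   [X, Y]^i = X(Y^i) - Y(X^i). *)
Definition bracket (X Y : F) : F := fun p => along X Y p - along Y X p.

Definition connection := F -> F -> F.

Definition is_connection (nabla : connection) : Prop :=
  [/\ forall X Y, vector_field X -> vector_field Y ->
        vector_field (nabla X Y),
      forall X X' Y, vector_field X -> vector_field X' -> vector_field Y ->
        nabla (addf X X') Y = addf (nabla X Y) (nabla X' Y),
      forall f X Y, smooth_fun f -> vector_field X -> vector_field Y ->
        nabla (scalef f X) Y = scalef f (nabla X Y),
      forall X Y Y', vector_field X -> vector_field Y -> vector_field Y' ->
        nabla X (addf Y Y') = addf (nabla X Y) (nabla X Y') &
      forall f X Y, smooth_fun f -> vector_field X -> vector_field Y ->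
        nabla X (scalef f Y) =
        addf (scalef (derivation X f) Y) (scalef f (nabla X Y))].

Definition is_metric (nabla : connection) : Prop :=
  forall X Y Z, vector_field X -> vector_field Y -> vector_field Z ->
    forall p, derivation X (metric Y Z) p =
              metric (nabla X Y) Z p + metric Y (nabla X Z) p.

Definition torsion (nabla : connection) (X Y : F) : F :=
  subf (subf (nabla X Y) (nabla Y X)) (bracket X Y).

Definition is_levi_civita (nabla : connection) : Prop :=
  [/\ is_connection nabla, is_metric nabla &
      forall X Y, vector_field X -> vector_field Y ->
        forall p, torsion nabla X Y p = 0].

Definition is_3form (w : F -> F -> F -> S -> R) : Prop :=
  [/\ forall X Y Z, vector_field X -> vector_field Y -> vector_field Z ->
        smooth_fun (w X Y Z),
      forall X X' Y Z, vector_field X -> vector_field X' ->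
        vector_field Y -> vector_field Z ->
        forall p, w (addf X X') Y Z p = w X Y Z p + w X' Y Z p,
      forall f X Y Z, smooth_fun f -> vector_field X ->
        vector_field Y -> vector_field Z ->
        forall p, w (scalef f X) Y Z p = f p * w X Y Z p,
      forall X Y Z, vector_field X -> vector_field Y -> vector_field Z ->
        forall p, w Y X Z p = - w X Y Z p &
      forall X Y Z, vector_field X -> vector_field Y -> vector_field Z ->
        forall p, w X Z Y p = - w X Y Z p].

Definition has_skew_torsion (nabla : connection) : Prop :=
  is_3form (fun X Y Z => metric (torsion nabla X Y) Z).

Definition act (s : 'M[R[i]]_n.+1) (p : E) : E := ofC (s *m toC p).

Definition SU (s : 'M[R[i]]_n.+1) : Prop := s \is unitarymx /\ \det s = 1.

(* For unitary s the default value is never used, see val_act_sphere. *)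
Definition act_sphere (s : 'M[R[i]]_n.+1) (p : S) : S :=
  insubd p (act s (val p)).

Lemma dot_toC (p : E) :
  ((map_mx conjc (toC p))^T *m toC p) 0 0 = (dot p p)%:C%C.
Proof.
rewrite /dot !mxE big_split_ord /= -big_split /=.
rewrite [RHS](rmorph_sum (real_complex R)) /=.
apply: eq_bigr => k _; rewrite !mxE /=.
by apply/eqP; rewrite eq_complex /= mulNr opprK mulNr [X in _ - X]mulrC
  subrr !eqxx.
Qed.

Lemma toCK : cancel (@toC R n) (@ofC R n).
Proof.
move=> p; rewrite -[RHS]vsubmxK /ofC; congr col_mx;
  by apply/matrixP => k j; rewrite !mxE ord1.
Qed.

Lemma ofCK : cancel (@ofC R n) (@toC R n).
Proof.
move=> z; apply/matrixP => k j; rewrite !mxE ord1.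
case: splitP => [k' /= e|k' /= e]; last first.
  by have := ltn_ord k; rewrite e ltnNge leq_addr.
case: splitP => [k2 /= e2|k2 /= e2].
  by have := ltn_ord k2; rewrite -e2 ltnNge leq_addr.
have -> : k' = k by apply/val_inj.
have -> : k2 = k by apply/val_inj; move/eqP: e2; rewrite eqn_add2l => /eqP.
by rewrite !mxE; case: (z k 0).
Qed.

Lemma val_act_sphere s p : s \is unitarymx ->
  val (act_sphere s p) = act s (val p).
Proof.
move=> us; rewrite val_insubd ifT //.
case: p => p' /= /eqP hp.
suff: (dot (act s p') (act s p'))%:C%C = (dot p' p')%:C%C :> R[i].
  by move=> /(@complexI R) ->; apply/eqP.
rewrite -!dot_toC ofCK map_mxM trmx_mul -mulmxA [X in _ *m X]mulmxA.
suff -> : (map_mx conjc s)^T *m s = 1%:M by rewrite mul1mx.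
by apply: mulmx1C; rewrite map_trmx; apply/unitarymxP.
Qed.

Definition tau (s : 'M[R[i]]_n.+1) (X : F) : F :=
  fun p => act s (X (act_sphere (invmx s) p)).

Definition is_invariant (nabla : connection) : Prop :=
  forall s X Y, SU s -> vector_field X -> vector_field Y ->
    tau s (nabla X Y) = nabla (tau s X) (tau s Y).

Definition xi : F := fun p => - mul_i (val p).

(* i X = psi X + eta(X) N with unit outward normal N_p = p. *)
Definition eta (X : F) : S -> R := fun p => dot (mul_i (X p)) (val p).
Definition psi (X : F) : F := fun p => mul_i (X p) - eta X p *: val p.
Definition Phi (X Y : F) : S -> R := metric X (psi Y).

Definition curvature (nabla : connection) (X Y Z : F) : F :=
  subf (subf (nabla X (nabla Y Z)) (nabla Y (nabla X Z)))
       (nabla (bracket X Y) Z).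

(* A vector field with value v at p, for v tangent at p: the tangential
   projection of the constant field v. *)
Definition vf_of (v : E) : F := fun p => v - dot v (val p) *: val p.

Lemma tangentE (p : S) (v : E) : (v \in tangent p) = (dot (val p) v == 0).
Proof.
rewrite memv_ker lfunE /=; apply/idP/idP => /eqP e; apply/eqP.
  by rewrite /dot e mxE.
by apply/matrixP => i j; rewrite !ord1 [RHS]mxE.
Qed.

Lemma vf_of_id (p : S) (v : E) : v \in tangent p -> vf_of v p = v.
Proof.
rewrite tangentE /vf_of => /eqP e.
have -> : dot v (val p) = dot (val p) v.
  by rewrite /dot -[v^T *m _]trmxK trmx_mul trmxK mxE.
by rewrite e scale0r subr0.
Qed.

Definition trace_on (V : {vspace E}) (f : E -> E) : R :=
  \sum_(i < \dim V) coord (vbasis V) i (f (vbasis V)`_i).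

(* Tensors are evaluated at p on a tangent vector v through vf_of v. *)
Definition ricci (nabla : connection) (Y Z : F) : S -> R :=
  fun p => trace_on (tangent p) (fun x => curvature nabla (vf_of x) Y Z p).

(* \sum_(i, j) g^{ij} B(b_i, b_j) for the basis (b_i) of the tangent space. *)
Definition gtrace (B : F -> F -> S -> R) : S -> R := fun p =>
  let b := vbasis (tangent p) in
  let G := \matrix_(i < \dim (tangent p), j < \dim (tangent p))
             dot b`_i b`_j in
  \sum_i \sum_j invmx G i j * B (vf_of b`_i) (vf_of b`_j) p.

Definition scalar_curvature (nabla : connection) : S -> R :=
  gtrace (ricci nabla).

Definition Sym (B : F -> F -> S -> R) : F -> F -> S -> R :=
  fun X Y p => (B X Y p + B Y X p) / 2.

Definition is_einstein (nabla : connection) : Prop :=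
  [/\ is_metric nabla, has_skew_torsion nabla &
      forall X Y, vector_field X -> vector_field Y ->
        forall p, Sym (ricci nabla) X Y p =
                  scalar_curvature nabla p / (2 * n + 1)%:R * metric X Y p].

Definition nabla_r (nablag : connection) (r : R) : connection :=
  fun X Y p => nablag X Y p +
    r *: (Phi X Y p *: xi p - eta X p *: psi Y p + eta Y p *: psi X p).

End Geometry.

(* Main.v *)
(* On tangent fields of the sphere, [nabla_r] is the flat derivative of C^{n+1} plus
   the tensor [cform r] at the base point; differentiating that tensor along with the
   base point makes the curvature an algebraic expression in it, and Ric and the scalar
   curvature are its traces over a frame of the tangent space.

   Conversely, two invariant metric connections with totally skew torsion differ by an
   invariant 3-form.  At e_0 it is preserved by the product of any two reflections
   z_m -> - z_m with m <> 0; for n >= 4 some index is always left over for the second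
   reflection, so every component of the form vanishes except those on
   (i e_0, e_k, i e_k), which the permutations of e_1, ..., e_n make equal.  One number
   thus determines the connection, which is therefore some [nabla_r].  Comparing
   Ric(xi, xi) with Ric(e_1, e_1) in the Einstein equation then forces r = 0. *)

Require Import Defs.
From HB Require Import structures.
From mathcomp Require Import all_boot all_order all_algebra fingroup perm.
From mathcomp Require Import spectral sesquilinear complex ring lra.
From mathcomp Require Import boolp classical_sets reals topology normedtype derive realfun.
Set Implicit Arguments.
Unset Strict Implicit.
Unset Printing Implicit Defensive.
Import Defs Order.TTheory GRing.Theory Num.Theory.
Import numFieldNormedType.Exports.
Local Open Scope classical_set_scope.
Local Open Scope ring_scope.

(** Smoothness and differentiation are defined through directional derivatives of the radial
    extension, so neither linearity in the direction nor symmetry of second derivatives comes with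
    the definitions. Both are recovered from mean values and the continuity of the derivatives; they
    are what make the componentwise bracket act as a commutator and the ambient derivative flat. A
    connection is constrained on vector fields only, although it takes arbitrary maps as arguments,
    so connections are compared through [agree]. The Levi-Civita connection is given by its
    characterisation alone and has to be identified with the explicit [sasaki_connection 0] before
    anything can be computed. The tensor algebra lives in an abstract [hermitian_space]: a vector
    identity is tested against an arbitrary vector and becomes a polynomial identity. The 3-form at
    e_0 is extended to all of C^{n+1} through the tangential projection. It then kills e_0, and the
    standard real basis replaces a basis of the tangent space. *)

Lemma sub_add_sub (V : zmodType) (a b c d : V) : a + b - (c + d) - (a - c) = b - d.
Proof. by rewrite opprD addrACA [a - c + _]addrC addrK. Qed.

Lemma sub_torsion (V : zmodType) (a b c d t : V) :
  a - b - (c - d) = a - c - t - (b - d - t).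
Proof. by rewrite [in RHS]opprB subrKA !opprD addrACA. Qed.

(* The braid argument: a trilinear form symmetric in its first two and skew in
   its last two arguments vanishes. *)
Lemma braid0 (R : realFieldType) (a b c d e f : R) :
  a = b -> b = - c -> c = d -> d = - e -> e = f -> f = - a -> a = 0.
Proof. by lra. Qed.

(** Models C^{n+1} as a real space with its Euclidean product and multiplication by i, both kept
    opaque so that [ring] treats products of vectors as atoms. Definiteness enters as [ip_eq0],
    which makes [ip_inj] available. *)
Record hermitian_space (R : realFieldType) (V : lmodType R) := HermitianSpace {
  ip : V -> V -> R;
  jj : V -> V;
  ipC : forall u v, ip u v = ip v u;
  ip_eq0 : forall u, ip u u = 0 -> u = 0;
  ipDl : forall u v w, ip (u + v) w = ip u w + ip v w;
  ipZl : forall a u v, ip (a *: u) v = a * ip u v;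
  jjD : forall u v, jj (u + v) = jj u + jj v;
  jjZ : forall a u, jj (a *: u) = a *: jj u;
  jjK : forall u, jj (jj u) = - u;
  ip_jj : forall u v, ip (jj u) (jj v) = ip u v }.

(** * Hermitian linear algebra *)

Section HermitianAlgebra.
Variables (R : realFieldType) (V : lmodType R) (H : hermitian_space V).
Local Notation ip := (ip H).
Local Notation jj := (jj H).
Implicit Types (u v w x y z q : V) (r c : R).

Lemma ipNl u v : ip (- u) v = - ip u v.
Proof. by rewrite -scaleN1r ipZl mulN1r. Qed.

Lemma ipDr u v w : ip w (u + v) = ip w u + ip w v.
Proof. by rewrite !(ipC H w) ipDl. Qed.

Lemma ipZr c u v : ip u (c *: v) = c * ip u v.
Proof. by rewrite !(ipC H u) ipZl. Qed.

Lemma ipNr u v : ip u (- v) = - ip u v.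
Proof. by rewrite !(ipC H u) ipNl. Qed.

Lemma jjN u : jj (- u) = - jj u.
Proof. by rewrite -scaleN1r jjZ scaleN1r. Qed.

Lemma ip_suml (I : finType) (f : I -> V) u :
  ip (\sum_i f i) u = \sum_i ip (f i) u.
Proof.
apply: (big_morph (fun v => ip v u)) => [v w|]; first exact: ipDl.
by rewrite -(scale0r 0) ipZl mul0r.
Qed.

(** In the hypothesis one derivative of a product is computed with two metric connections;
    subtracting shows that their difference is a skew endomorphism. *)
Lemma ip_sub_skew u v u' v' y z :
  ip u z + ip y u' = ip v z + ip y v' -> ip (u' - v') y = - ip (u - v) z.
Proof. by rewrite !ipDl !ipNl !(ipC H y); lra. Qed.

Lemma ip_jjl u v : ip (jj u) v = - ip u (jj v).
Proof. by rewrite -[LHS](ip_jj H) jjK ipNl. Qed.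

Lemma ip_jjC u v : ip u (jj v) = - ip v (jj u).
Proof. by rewrite ipC ip_jjl. Qed.

Lemma ip_jj_self u : ip u (jj u) = 0.
Proof. by have := ip_jjC u u; lra. Qed.

Definition ipE := (ipDl, ipDr, ipZl, ipZr, ipNl, ipNr, jjD, jjZ, jjN, jjK, ip_jjl, ip_jj_self).

(* At a point [q] of the unit sphere, [- jj q] is xi and [ip (jj x) q] is [eta x]; the
   term [ip x y *: q] turns the flat derivative into the Levi-Civita connection. *)
Definition cform r q x y : V :=
  ip x y *: q + r *: (- ip x (jj y) *: jj q - ip (jj x) q *: jj y + ip (jj y) q *: jj x).

Lemma ip_cform r q x y z : ip (cform r q x y) z =
  ip x y * ip q z + r * (- ip x (jj y) * ip (jj q) z - ip (jj x) q * ip (jj y) z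
    + ip (jj y) q * ip (jj x) z).
Proof. by rewrite /cform !(ipDl, ipZl, ipNl). Qed.

Lemma ip_inj u v : (forall w, ip u w = ip v w) -> u = v.
Proof.
move=> E; apply/eqP; rewrite -subr_eq0; apply/eqP/(@ip_eq0 _ _ H).
by rewrite ipDl ipNl E subrr.
Qed.

Lemma cformDl r q x x' y : cform r q (x + x') y = cform r q x y + cform r q x' y.
Proof. by apply: ip_inj => w; rewrite ipDl !ip_cform !(ipDl, jjD); ring. Qed.

Lemma cformZl r q c x y : cform r q (c *: x) y = c *: cform r q x y.
Proof. by apply: ip_inj => w; rewrite ipZl !ip_cform !(ipZl, jjZ); ring. Qed.

Lemma cformDr r q x y y' : cform r q x (y + y') = cform r q x y + cform r q x y'.
Proof. by apply: ip_inj => w; rewrite ipDl !ip_cform !(ipDl, ipDr, jjD); ring. Qed.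

Lemma cformZr r q c x y : cform r q x (c *: y) = c *: cform r q x y.
Proof. by apply: ip_inj => w; rewrite ipZl !ip_cform !(ipZl, ipZr, jjZ); ring. Qed.

Lemma cformBl r q x x' y : cform r q (x - x') y = cform r q x y - cform r q x' y.
Proof. by rewrite cformDl -(scaleN1r x') cformZl scaleN1r. Qed.

(** The [r] part is orthogonal to [q]: [jj q] is, and the two remaining products cancel. The normal
    component that is left will offset that of the flat derivative. *)
Lemma ip_base_cform r q x y : ip q q = 1 -> ip q (cform r q x y) = ip x y.
Proof. by move=> q1; rewrite ipC ip_cform q1 (ip_jjl q) ip_jj_self; ring. Qed.

Lemma cform_skew r q x y z : ip y q = 0 -> ip z q = 0 ->
  ip (cform r q x y) z + ip y (cform r q x z) = 0.
Proof.
move=> yq zq; rewrite (ipC H y) !ip_cform (ipC H q z) (ipC H q y) yq zq.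
by rewrite !ip_jjl (ip_jjC q z) (ip_jjC q y) (ip_jjC z y) (ip_jjC z q); ring.
Qed.

(** Links [cform] to the formula with Phi, eta and psi. The normal parts subtracted by psi
    disappear: the one inside Phi because [x] is orthogonal to [q], the other two because they are
    the same product with opposite signs. *)
Lemma cform_sasaki r q x y : ip x q = 0 ->
  ip x y *: q + r *: (ip x (jj y - ip (jj y) q *: q) *: - jj q
    - ip (jj x) q *: (jj y - ip (jj y) q *: q)
    + ip (jj y) q *: (jj x - ip (jj x) q *: q)) = cform r q x y.
Proof. by move=> xq; apply: ip_inj => w; rewrite /cform !ipE xq; ring. Qed.

Lemma cform0 q x y : cform 0 q x y = ip x y *: q.
Proof. by rewrite /cform scale0r addr0. Qed.

(** This component is the parameter itself, so [r] can be read off a connection by evaluating on (i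
    q, y, i y). *)
Lemma cform_hopf r q y : ip q q = 1 -> ip y y = 1 -> ip q y = 0 -> ip q (jj y) = 0 ->
  ip (cform r q (jj q) y) (jj y) = r.
Proof.
move=> q1 y1 qy qJy; rewrite ip_cform jjK !ipNl !ip_jj q1 y1 qy (ip_jjl q) qJy.
by rewrite ?qy; ring.
Qed.

Lemma cform_isometry (T : V -> V) r q x y :
  (forall u v, T (u + v) = T u + T v) -> (forall a u, T (a *: u) = a *: T u) ->
  (forall u, T (jj u) = jj (T u)) -> (forall u v, ip (T u) (T v) = ip u v) ->
  T (cform r q x y) = cform r (T q) (T x) (T y).
Proof.
move=> TD TZ TJ Tip; have TN u : T (- u) = - T u by rewrite -scaleN1r TZ scaleN1r.
by rewrite /cform !(TD, TZ, TN) -!TJ !Tip.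
Qed.

Definition tform r q x y : V := cform r q x y - ip x y *: q.

(** The symmetric term [ip x y *: q] cancels, while the rest is already skew in [x] and [y] and is
    therefore doubled. *)
Lemma cform_torsion r q x y : cform r q x y - cform r q y x = tform (2 * r) q x y.
Proof.
by apply: ip_inj => w; rewrite /tform /cform !ipE (ipC H y x) (ip_jjC y x); ring.
Qed.

Lemma tformDl r q x x' y : tform r q (x + x') y = tform r q x y + tform r q x' y.
Proof. by rewrite /tform cformDl ipDl scalerDl opprD addrACA. Qed.

Lemma tformZl r q c x y : tform r q (c *: x) y = c *: tform r q x y.
Proof. by rewrite /tform cformZl ipZl -scalerA scalerBr. Qed.

Lemma tformC r q x y z : ip (tform r q y x) z = - ip (tform r q x y) z.
Proof. by rewrite /tform /cform !ipE (ipC H y x) (ip_jjC y x); ring. Qed.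

Lemma tform_skew r q x y z : ip y q = 0 -> ip z q = 0 ->
  ip (tform r q x z) y = - ip (tform r q x y) z.
Proof.
move=> yq zq; have := cform_skew r x yq zq; rewrite (ipC H y) /tform !ipE.
by rewrite (ipC H q y) (ipC H q z) yq zq; lra.
Qed.

(* The coefficients [0] and [-1] come from differentiating the constants in the
   expression of [cform] through products of functions and fields. *)
Lemma cform_leibniz r q q' x x' y y' u v :
  (ip x' y + ip x y') *: q + ip x y *: q' + (0 *: u + r *: (
    - (ip x' (jj y) + ip x (jj y')) *: jj q + - ip x (jj y) *: jj q'
    + (0 *: v + -1 *: ((ip (jj x') q + ip (jj x) q') *: jj y + ip (jj x) q *: jj y'))
    + ((ip (jj y') q + ip (jj y) q') *: jj x + ip (jj y) q *: jj x'))) =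
  cform r q' x y + cform r q x' y + cform r q x y'.
Proof. by apply: ip_inj => w; rewrite /cform !ipE; ring. Qed.

(** [cform] is linear in its base point, and the position has derivative [x] in a tangent direction
    [x]. So [cform r x y z], with [x] in the slot of the base point, is the derivative of the
    tensor; the last two terms are the commutator of the tensor with itself. *)
Definition curv r q x y z : V := cform r x y z - cform r y x z
  + cform r q x (cform r q y z) - cform r q y (cform r q x z).

(** Here [a], [b] stand for the second flat derivatives of Z, [u], [v] for the derivatives of Y
    along X and of X along Y, [s], [t] for those of Z along X and along Y. All six cancel, which is
    the tensoriality of the curvature. *)
Lemma curv_expand r q x y z a b u v s t :
  (a + (cform r x y z + cform r q u z + cform r q y s) + cform r q x (t + cform r q y z))
  - (b + (cform r y x z + cform r q v z + cform r q x t) + cform r q y (s + cform r q x z))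
  - (a - b + cform r q (u - v) z) = curv r q x y z.
Proof.
rewrite (cformDr r q x t) (cformDr r q y s) cformBl /curv.
move: (cform r x y z) (cform r q u z) (cform r q y s) (cform r q x t) => c1 c2 c3 c4.
move: (cform r q x (cform r q y z)) (cform r q y (cform r q x z)) => c5 c6.
move: (cform r y x z) (cform r q v z) => c7 c8.
by apply: ip_inj => w; rewrite !(ipDl, ipNl); ring.
Qed.

(** * Traces over a frame of the orthogonal complement of a unit vector *)

Section Trace.
Variables (m : nat) (q : V) (b : 'I_m -> V) (g : 'M[R]_m).
Hypothesis q1 : ip q q = 1.
Hypothesis bq : forall i, ip (b i) q = 0.
Hypothesis gC : forall i j, g i j = g j i.
Hypothesis gK : forall i k, \sum_j g i j * ip (b j) (b k) = (i == k)%:R.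

(** The frame need not be orthonormal, hence the inverse Gram matrix [g]. This is the coordinate
    functional on vectors orthogonal to [q], and it vanishes on [q], so a vector need not be
    projected before its trace is taken. *)
Definition dual i v : R := \sum_j g i j * ip (b j) v.

Hypothesis span : forall v, ip v q = 0 -> v = \sum_i dual i v *: b i.

Lemma dualD i u v : dual i (u + v) = dual i u + dual i v.
Proof. by rewrite -big_split; apply: eq_bigr => j _; rewrite ipDr mulrDr. Qed.

Lemma dualZ i c v : dual i (c *: v) = c * dual i v.
Proof. by rewrite mulr_sumr; apply: eq_bigr => j _; rewrite ipZr; ring. Qed.

Lemma dualN i v : dual i (- v) = - dual i v.
Proof. by rewrite -scaleN1r dualZ mulN1r. Qed.

Lemma dual_sum i (I : finType) (c : I -> R) (f : I -> V) :
  dual i (\sum_k c k *: f k) = \sum_k c k * dual i (f k).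
Proof.
rewrite (big_morph (dual i) (id1 := 0) (op1 := +%R)).
- by apply: eq_bigr => k _; rewrite dualZ.
- exact: dualD.
- by rewrite -(scale0r 0) dualZ mul0r.
Qed.

Lemma dual_base i : dual i q = 0.
Proof. by rewrite /dual big1 // => j _; rewrite bq mulr0. Qed.

Lemma dual_frame i k : dual i (b k) = (i == k)%:R.
Proof. exact: gK. Qed.

Lemma trace_id : \sum_i dual i (b i) = m%:R.
Proof.
under eq_bigr do rewrite dual_frame eqxx.
by rewrite sumr_const card_ord.
Qed.

(** [dual] sees only the projection [w'] of [w] orthogonal to [q]; recombining the frame expansion
    of [w'] leaves [ip w' u]. *)
Lemma trace_rank1 u w :
  \sum_i ip (b i) u * dual i w = ip w u - ip w q * ip q u.
Proof.
pose w' := w - ip w q *: q.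
have wq : ip w' q = 0 by rewrite !ipE q1; ring.
have dw i : dual i w = dual i w' by rewrite dualD dualN dualZ dual_base; ring.
under eq_bigr do rewrite dw mulrC -ipZl.
by rewrite -ip_suml -span // /w' !(ipDl, ipNl, ipZl).
Qed.

Lemma trace_skew : \sum_i dual i (jj (b i)) = 0.
Proof.
set S := \sum_i _; suff : S = - S by lra.
rewrite -[RHS]sumrN {1}/S /dual exchange_big; apply: eq_bigr => j _ /=.
by rewrite -sumrN; apply: eq_bigr => i _; rewrite gC (ip_jjC (b j)); ring.
Qed.

Lemma trace_metric : \sum_i \sum_j g i j * ip (b i) (b j) = m%:R.
Proof.
rewrite -trace_id; apply: eq_bigr => i _; apply: eq_bigr => j _.
by rewrite (ipC H (b i)).
Qed.

Lemma trace_square u : ip u q = 0 ->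
  \sum_i \sum_j g i j * (ip (b i) u * ip (b j) u) = ip u u.
Proof.
move=> uq; have := trace_rank1 u u; rewrite uq mul0r subr0 => <-.
apply: eq_bigr => i _; rewrite mulr_sumr; apply: eq_bigr => j _; ring.
Qed.

(** The identity contributes [m], [jj] is traceless, and the rank-one maps supply the corrections:
    -1 and -2 r^2 to the coefficient of [ip y z], and +3 r^2 to that of the product of the eta
    terms. At [r = 0] this is the Ricci tensor [m - 1] of the unit sphere. *)
Lemma trace_curv r y z : ip y q = 0 -> ip z q = 0 ->
  \sum_i dual i (curv r q (b i) y z) =
  (m%:R - 1 - 2 * r ^+ 2) * ip y z - (m%:R - 3) * r ^+ 2 * (ip y (jj q) * ip z (jj q)).
Proof.
move=> yq zq.
have qy : ip q y = 0 by rewrite ipC.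
have qz : ip q z = 0 by rewrite ipC.
pose ey := ip y (jj q); pose ez := ip z (jj q).
pose yz := ip y z; pose yJz := ip y (jj z).
(* As a map of [b i], the curvature is a combination of the identity, [jj] and rank-one maps; its
   terms along [q] are killed by [dual]. *)
have E i : dual i (curv r q (b i) y z) =
   (yz - r ^+ 2 * (ey * ez)) * dual i (b i)
   + (r ^+ 2 - 2 * r) * yJz * dual i (jj (b i))
   + -1 * (ip (b i) z * dual i y)
   + (2 * r - r ^+ 2) * (ip (b i) (jj z) * dual i (jj y))
   + - (2 * r) * (ip (b i) (jj y) * dual i (jj z))
   + r ^+ 2 * ey * (ip (b i) z * dual i (jj q))
   + - (r ^+ 2 * yz) * (ip (b i) (jj q) * dual i (jj q))
   + r ^+ 2 * ez * (ip (b i) (jj q) * dual i y).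
  have bqi := bq i.
  have qb : ip q (b i) = 0 by rewrite ipC.
  rewrite /curv !(dualD, dualN) /cform.
  rewrite !(dualD, dualN, dualZ, dual_base, jjD, jjZ, jjN, jjK).
  rewrite !(ipDl, ipDr, ipZl, ipZr, ipNl, ipNr) !ip_jjl.
  rewrite (ip_jjC y (b i)) (ip_jjC z (b i)) (ip_jjC z y).
  rewrite (ipC H y (b i)) !ip_jj_self.
  rewrite ?q1 ?yq ?zq ?qy ?qz ?bqi ?qb.
  by rewrite /ey /ez /yz /yJz; ring.
rewrite (eq_bigr _ (fun i _ => E i)) !big_split /= -!mulr_sumr.
rewrite trace_id trace_skew !trace_rank1 ?yq ?zq ?qy ?qz !ip_jjl !jjK !ip_jj_self !ipNr q1.
rewrite (ip_jjC q y) (ip_jjC q z) (ipC H z y) /ey /ez /yz; ring.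
Qed.

End Trace.
End HermitianAlgebra.

(** * Unitary matrices *)

Section Unitary.
Variables (C : numClosedFieldType) (m : nat).
Implicit Types (s t : 'M[C]_m.+1) (a b c k : 'I_m.+1).

Definition reflmx c : 'M[C]_m.+1 := diag_mx (\row_k (if k == c then -1 else 1)).

Lemma diag_unitary (d : 'rV[C]_m.+1) :
  (forall k, d 0 k * (d 0 k)^* = 1) -> diag_mx d \is unitarymx.
Proof.
move=> d1; apply/unitarymxP; rewrite tr_diag_mx map_diag_mx mulmx_diag -diag_const_mx.
by congr diag_mx; apply/rowP => j; rewrite !mxE.
Qed.

Lemma reflmx_unitary c : reflmx c \is unitarymx.
Proof.
apply: diag_unitary => k; rewrite mxE.
by case: (k == c); rewrite ?rmorphN ?rmorph1 ?mulrNN mulr1.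
Qed.

Lemma det_reflmx c : \det (reflmx c) = -1.
Proof.
rewrite det_diag (bigD1 c) //= mxE eqxx big1 ?mulr1 // => k /negbTE kc.
by rewrite mxE kc.
Qed.

Lemma reflmx_mul_delta c k :
  reflmx c *m delta_mx k 0 = (if k == c then -1 else 1) *: delta_mx k 0 :> 'cV_m.+1.
Proof.
apply/matrixP => i j; rewrite mul_diag_mx !mxE.
by case: (eqVneq i k) => [->|ik] //=; rewrite !mulr0.
Qed.

Lemma swap_mul_delta a b k :
  tperm_mx a b *m delta_mx k 0 = delta_mx (tperm a b k) 0 :> 'cV[C]_m.+1.
Proof.
apply/matrixP => i j; rewrite -row_permE !mxE; congr ((_ && _)%:R).
by rewrite -(inj_eq (@perm_inj _ (tperm a b))) tpermK.
Qed.

Lemma swap_unitary a b : (tperm_mx a b : 'M[C]_m.+1) \is unitarymx.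
Proof.
apply/unitarymxP; rewrite /tperm_mx tr_perm_mx map_perm_mx -perm_mxM mulgV.
by rewrite perm_mx1.
Qed.

Lemma det_swap a b : a != b -> \det (tperm_mx a b : 'M[C]_m.+1) = -1.
Proof. by move=> ab; rewrite det_perm odd_tperm ab expr1. Qed.

(** Reflections and transpositions have determinant -1, so they enter the special unitary group only
    in pairs. *)
Lemma SU_mul s t : s \is unitarymx -> t \is unitarymx ->
  \det s = -1 -> \det t = -1 -> (s *m t) \is unitarymx /\ \det (s *m t) = 1.
Proof.
move=> us ut ds dt; split; first exact: mul_unitarymx.
by rewrite det_mulmx ds dt mulrNN mulr1.
Qed.

Lemma det_unitary s : s \is unitarymx -> \det s * (\det s)^* = 1.
Proof.
move=> /unitarymxP /(congr1 determinant); rewrite det_mulmx det1.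
by rewrite det_map_mx det_tr.
Qed.

Lemma unitary_row (z : 'rV[C]_m.+1) : (z *m (map_mx Num.conj z^T)) 0 0 = 1 ->
  exists2 s : 'M[C]_m.+1, s \is unitarymx & row ord0 s = z.
Proof.
(* All rows are set to [z]: [schmidt] returns a unitary matrix even for dependent rows, and only its
   first row is compared with [z]. *)
move=> z1; pose A : 'M[C]_m.+1 := \matrix_(i, j) z 0 j.
have uB : schmidt A \is unitarymx by exact: schmidt_unitarymx.
exists (schmidt A) => //.
have rA : row ord0 A = z by apply/rowP => j; rewrite !mxE.
have := row_schmidt_sub A ord0; have := form1_row_schmidt A ord0.
rewrite (big_pred1 ord0) => [|k]; last by rewrite leqn0.
rewrite genmxE rA dotmxE => pos /sub_rVP[a za].
have r1 : (row ord0 (schmidt A) *m (map_mx Num.conj (row ord0 (schmidt A))^T)) 0 0 = 1.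
  have /row_unitarymxP/(_ ord0 ord0) := uB; by rewrite dotmxE eqxx.
move: pos; rewrite za -scalemxAl mxE r1 mulr1 => a0.
(* [z] is [a] times the first row of [schmidt A], and [schmidt] makes [a] nonnegative; unit length
   then leaves [a = 1]. *)
have : a * a^* = 1.
  rewrite -z1 za linearZ /= map_mxZ -scalemxAl -scalemxAr scalerA.
  by rewrite [RHS]mxE r1 mulr1.
rewrite conj_Creal ?ger0_real // => /eqP; rewrite -expr2 pexpr_eq1 // => /eqP ->.
by rewrite scale1r.
Qed.

Lemma SU_row (z : 'rV[C]_m.+1) : (0 < m)%N ->
  (z *m (map_mx Num.conj z^T)) 0 0 = 1 ->
  exists s : 'M[C]_m.+1, [/\ s \is unitarymx, \det s = 1 & row ord0 s = z].
Proof.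
move=> m0 /unitary_row[B uB rB].
(* The determinant is corrected in the last row, which differs from the prescribed first row because
   [0 < m]. *)
pose D : 'M[C]_m.+1 := diag_mx (\row_k (if k == ord_max then (\det B)^* else 1)).
have uD : D \is unitarymx.
  apply: diag_unitary => k; rewrite mxE.
  by case: (k == ord_max); rewrite ?rmorph1 ?mulr1 // conjCK mulrC det_unitary.
have dD : \det D = (\det B)^*.
  rewrite det_diag (bigD1 ord_max) //= mxE eqxx big1 ?mulr1 // => k /negbTE kc.
  by rewrite mxE kc.
exists (D *m B); split; first exact: mul_unitarymx.
  by rewrite det_mulmx dD mulrC det_unitary.
rewrite -rB; apply/rowP => j; rewrite mxE [in RHS]mxE mul_diag_mx !mxE.
by rewrite -val_eqE /= eq_sym (gtn_eqF m0) mul1r.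
Qed.

End Unitary.

(** * Calculus in the ambient space *)

Section CkCalculus.
Variables (R : realType) (n : nat).
Local Notation E := (Cspace R n).
Implicit Types (U : set E).

Lemma near_open_eq (T : topologicalType) (W : Type) (U : set T) (F G : T -> W) x :
  open U -> (forall y, U y -> F y = G y) -> U x -> \forall y \near x, F y = G y.
Proof.
by move=> oU FG Ux; near=> y; apply: FG; near: y; exact: open_nbhs_nbhs.
Unshelve. all: by end_near. Qed.

Lemma continuous_open_eq (T U : topologicalType) (D : set T) (F G : T -> U) x :
  open D -> (forall y, D y -> F y = G y) -> D x ->
  {for x, continuous F} -> {for x, continuous G}.
Proof.
move=> oD FG Dx; rewrite /prop_for /continuous_at -(FG x Dx).
exact: cvg_trans (near_eq_cvg (near_open_eq oD FG Dx)).
Qed.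

(** Values off the open set are irrelevant, so a radial extension may be replaced by a formula valid
    away from 0. *)
Lemma Ck_on_congr (W : normedModType R) k U (F G : E -> W) : open U ->
  (forall x, U x -> F x = G x) -> Ck_on k U F -> Ck_on k U G.
Proof.
move=> oU; elim: k F G => [|k IH] F G FG /= [cF dF].
  by split=> [x Ux|//]; exact: (continuous_open_eq oU FG Ux (cF x Ux)).
split=> [x Ux|v]; first exact: (continuous_open_eq oU FG Ux (cF x Ux)).
have [dFv CFv] := dF v; split=> [x Ux|].
  exact: near_eq_derivable (near_open_eq oU FG Ux) (dFv x Ux).
apply: IH CFv => x Ux; apply: near_eq_derive; exact: near_open_eq oU FG Ux.
Qed.

Lemma Ck_on_pred (W : normedModType R) k U (F : E -> W) :
  Ck_on k.+1 U F -> Ck_on k U F.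
Proof.
elim: k F => [|k IH] F; first by case.
by case=> cF dF; split=> // v; have [dFv /IH CFv] := dF v; split.
Qed.

Lemma Ck_on_cst (W : normedModType R) k U (c : W) : Ck_on k U (fun _ : E => c).
Proof.
elim: k c => [|k IH] c; first by split=> [x _|//]; exact: cst_continuous.
split=> [x _|v]; first exact: cst_continuous.
split=> [x _|]; first exact: derivable_cst.
have -> : (fun x : E => 'D_v (fun _ : E => c) x) = fun _ => 0.
  by apply/funext => x; rewrite (derive_cst c).
exact: IH.
Qed.

Lemma Ck_onD (W : normedModType R) k U (F G : E -> W) : open U ->
  Ck_on k U F -> Ck_on k U G -> Ck_on k U (fun x => F x + G x).
Proof.
move=> oU; elim: k F G => [|k IH] F G [cF dF] [cG dG].
  by split=> [x Ux|//]; exact: (continuousD (cF x Ux) (cG x Ux)).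
split=> [x Ux|v]; first by exact: (continuousD (cF x Ux) (cG x Ux)).
have [dFv CFv] := dF v; have [dGv CGv] := dG v; split=> [x Ux|].
  by apply: derivableD; [exact: dFv|exact: dGv].
apply: Ck_on_congr (IH _ _ CFv CGv) => // x Ux /=.
by rewrite -deriveD //; [exact: dFv|exact: dGv].
Qed.

Lemma Ck_onM k U (F G : E -> R^o) : open U ->
  Ck_on k U F -> Ck_on k U G -> Ck_on k U ((fun x => F x * G x) : E -> R^o).
Proof.
move=> oU; elim: k F G => [|k IH] F G CF CG.
all: have [cF dF] := CF; have [cG dG] := CG.
  by split=> [x Ux|//]; exact: (continuousM (cF x Ux) (cG x Ux)).
split=> [x Ux|v]; first by exact: (continuousM (cF x Ux) (cG x Ux)).
have [dFv CFv] := dF v; have [dGv CGv] := dG v; split=> [x Ux|].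
  by apply: derivableM; [exact: dFv|exact: dGv].
have H1 := IH _ _ (Ck_on_pred CF) CGv; have H2 := IH _ _ (Ck_on_pred CG) CFv.
apply: Ck_on_congr (Ck_onD oU H1 H2) => // x Ux /=.
by rewrite [RHS](@deriveM _ _ F G) //; [exact: dFv|exact: dGv].
Qed.

Lemma Ck_on_sum (W : normedModType R) (I : Type) (s : seq I) (P : pred I) k U
    (F : I -> E -> W) : open U ->
  (forall i, Ck_on k U (F i)) -> Ck_on k U (fun x => \sum_(i <- s | P i) F i x).
Proof.
move=> oU CF; elim: s => [|i s IH].
  have -> : (fun x => \sum_(i <- [::] | P i) F i x) = fun=> 0
    by apply/funext => x; rewrite big_nil.
  exact: Ck_on_cst.
have -> : (fun x => \sum_(j <- i :: s | P j) F j x) =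
    fun x => if P i then F i x + \sum_(j <- s | P j) F j x
             else \sum_(j <- s | P j) F j x
  by apply/funext => x; rewrite big_cons.
by case: (P i) => //; exact: Ck_onD.
Qed.

Lemma is_derive_coord (i : 'I_(n.+1 + n.+1)) (x v : E) :
  is_derive x v ((fun y : E => y i 0) : E -> R^o) (v i 0).
Proof.
have did : derivable (@id E) x v by exact: derivable_id.
have H := (derivable_mxP _ _ _).1 did.
split; first exact: H.
by have := congr1 (fun M : E => M i 0) (derive_mx did); rewrite derive_id mxE => ->.
Qed.

Lemma Ck_on_coord k U (i : 'I_(n.+1 + n.+1)) :
  Ck_on k U ((fun x : E => x i 0) : E -> R^o).
Proof.
case: k => [|k]; first by split=> [x _|//]; exact: coord_continuous.
split=> [x _|v]; first exact: coord_continuous.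
split=> [x _|]; first by have [] := is_derive_coord i x v.
have -> : (fun x : E => 'D_v ((fun y : E => y i 0) : E -> R^o) x) = fun _ => v i 0.
  by apply/funext => x; have [_ ->] := is_derive_coord i x v.
exact: Ck_on_cst.
Qed.

Lemma cvg_col (T : Type) (FF : set_system T) (G : T -> E) (l : E) :
  Filter FF -> (forall i, (fun t => G t i 0) @ FF --> l i 0) -> G @ FF --> l.
Proof.
move=> FFF cG; apply/cvgrPdist_le => e e0; near=> y.
rewrite /Num.Def.normr/= mx_normrE (bigmax_le _ (ltW e0))//= => i _.
rewrite !mxE; case: i => i j /=; rewrite (ord1 j).
move: i; near: y; apply: filter_forall => /= i.
by move/cvgrPdist_le: (cG i); apply.
Unshelve. all: by end_near. Qed.

Lemma continuous_mxP (F : E -> E) x :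
  {for x, continuous F} <->
  forall i, {for x, continuous ((fun y => F y i 0) : E -> R^o)}.
Proof.
split=> [cF i|cF].
  apply: (@continuous_comp _ _ _ F (fun M : E => M i 0 : R^o)) => //.
  exact: coord_continuous.
exact: (@cvg_col _ (nbhs x) F (F x)).
Qed.

Lemma derivable_colP (F : E -> E) x v :
  derivable F x v <-> forall i, derivable ((fun y => F y i 0) : E -> R^o) x v.
Proof.
split=> [/derivable_mxP dF i|dF]; first exact: dF.
by apply/derivable_mxP => i j; rewrite (ord1 j); exact: dF.
Qed.

Lemma derive_col (F : E -> E) x v i : derivable F x v ->
  'D_v F x i 0 = 'D_v ((fun y => F y i 0) : E -> R^o) x.
Proof. by move=> dF; rewrite derive_mx // mxE. Qed.

Lemma Ck_on_mxP k U (F : E -> E) : open U ->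
  Ck_on k U F <-> forall i, Ck_on k U ((fun y => F y i 0) : E -> R^o).
Proof.
move=> oU; elim: k F => [|k IH] F; split.
- by case=> cF _ i; split=> [x Ux|//]; move: i; apply/continuous_mxP; exact: cF.
- by move=> CF; split=> [x Ux|//]; apply/continuous_mxP => i; have [] := CF i; auto.
- case=> cF dF i; split=> [x Ux|v].
    by move: i; apply/continuous_mxP; exact: cF.
  have [dFv /IH CFv] := dF v; split=> [x Ux|].
    by move: i; apply/derivable_colP; exact: dFv.
  by apply: Ck_on_congr (CFv i) => // x Ux; rewrite derive_col //; exact: dFv.
- move=> CF; split=> [x Ux|v].
    by apply/continuous_mxP => i; have [cF _] := CF i; exact: cF.
  have dF x : U x -> derivable F x v.
    by move=> Ux; apply/derivable_colP => i; have [_ /(_ v)[d _]] := CF i; exact: d.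
  split=> //; apply/IH => i; have [_ /(_ v)[_ CFv]] := CF i.
  by apply: Ck_on_congr CFv => // x Ux; rewrite derive_col //; exact: dF.
Qed.

End CkCalculus.

(** * Directional derivatives: linearity in the direction and symmetry of second derivatives *)

Section DirectionalDerivatives.
Variables (R : realType) (V : normedModType R).
Implicit Types (F : V -> R^o) (x u v : V).

(** Restriction to a line turns a directional derivative into a one-variable derivative, to which
    the mean value theorem and the chain rule apply. *)
Lemma is_derive_line (W : normedModType R) (F : V -> W) v x t :
  derivable F (t *: v + x) v ->
  is_derive t (1 : R^o) (fun s : R^o => F (s *: v + x)) ('D_v F (t *: v + x)).
Proof.
move=> dF.
have E : (fun h : R => h^-1 *: (((fun s : R^o => F (s *: v + x)) \o shift (t : R^o)) (h *: (1 : R^o))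
            - F (t *: v + x))) =
  (fun h => h^-1 *: ((F \o shift (t *: v + x)) (h *: v) - F (t *: v + x))).
  by apply/funext => h /=; rewrite [h *: 1]mulr1 scalerDl addrA.
by split; rewrite /derivable /derive /= E.
Qed.

Lemma is_derive_line0 (W : normedModType R) (F : V -> W) v x d :
  is_derive (0 : R^o) (1 : R^o) (fun s : R^o => F (s *: v + x)) d ->
  is_derive x v F d.
Proof.
move=> [dF <-]; split; first exact/derivable1P.
rewrite /derive.
suff -> : (fun h => h^-1 *: ((F \o shift x) (h *: v) - F x)) =
  (fun h : R => h^-1 *: (((fun s : R => F (s *: v + x)) \o shift (0 : R^o))
     (h *: (1 : R^o)) - F (0 *: v + x))) by [].
by apply/funext => h /=; rewrite [h *: 1]mulr1 addr0 scale0r add0r.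
Qed.

Lemma is_deriveZdir F x v c : derivable F x v ->
  is_derive x (c *: v) F (c * 'D_v F x).
Proof.
move=> dF; have d0 : derivable F (0 *: v + x) v by rewrite scale0r add0r.
have := is_derive_line d0; rewrite scale0r add0r.
rewrite -[X in is_derive X](mulr0 c) => dg.
have df : is_derive (0 : R) (1 : R) ( *%R c) c.
  by apply: is_derive_eq; exact: mulr1.
have := is_derive1_comp dg df; rewrite mulrC => dgf.
apply: is_derive_line0.
suff -> : (fun s : R^o => F (s *: (c *: v) + x)) =
  (fun s : R => F (s *: v + x)) \o ( *%R c) by [].
by apply/funext => h /=; rewrite scalerA mulrC.
Qed.

Lemma mean_value0 (g dg : R -> R) (h : R) : 0 < h ->
  (forall t : R, 0 <= t <= h -> is_derive t (1 : R) g (dg t)) ->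
  exists2 c, 0 <= c <= h & g h - g 0 = dg c * h.
Proof.
move=> h0 Dg.
have [||c] := @MVT_segment R g dg 0 h (ltW h0).
- by move=> t /itvP th; apply: Dg; rewrite !th.
- apply: derivable_within_continuous => t /itvP th.
  by have [] := Dg t; rewrite ?th.
- by rewrite in_itv /= subr0 => ? ?; exists c.
Qed.

Lemma near_plane (P : set V) x u v : nbhs x P ->
  exists2 h0 : R, 0 < h0 &
    forall s t : R, 0 <= s <= h0 -> 0 <= t <= h0 -> P (s *: u + t *: v + x).
Proof.
move=> /nbhs_ballP [e /= e0 eP].
have N0 : 0 < `|u| + `|v| + 1 by rewrite ltr_wpDl // addr_ge0.
exists (e / (`|u| + `|v| + 1) / 2); first by rewrite !divr_gt0.
set h0 := _ / 2; move=> s t /andP[s0 sh] /andP[t0 th].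
apply: eP; rewrite -ball_normE /= opprD addrCA subrr addr0 normrN.
apply: le_lt_trans (ler_normD _ _) _; rewrite !normrZ !ger0_norm //.
have h00 : 0 < h0 by rewrite !divr_gt0.
have : s * `|u| + t * `|v| <= h0 * (`|u| + `|v| + 1).
  rewrite !mulrDr mulr1 -addrA lerD ?ler_wpM2r //.
  by apply: ler_wpDr; [exact: ltW|rewrite ler_wpM2r].
move=> /le_lt_trans; apply; rewrite /h0 mulrAC divfK ?gt_eqF //.
by rewrite ltr_pdivrMr // mulr_natr mulr2n ltrDl.
Qed.

Lemma norm_sub_eps (a b : R) : (forall e : R, 0 < e -> `|a - b| <= e) -> a = b.
Proof.
move=> H; apply/eqP; rewrite -subr_eq0 -normr_le0; apply/ler_addgt0Pl => e e0.
by rewrite addr0; exact: H.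
Qed.

Lemma close_trans (a b a' b' e : R) :
  `|a - a'| <= e / 2 -> `|b - b'| <= e / 2 -> a' = b' -> `|a - b| <= e.
Proof. move=> + + E; rewrite E !ler_norml => /andP[? ?] /andP[? ?]; apply/andP; lra. Qed.

Lemma quotient_eq (a b h s t : R) : h != 0 ->
  s = a * h * h -> t = b * h * h -> s = t -> a = b.
Proof. by move=> h0 -> -> /(mulIf h0) /(mulIf h0). Qed.

(** Directional derivability alone does not give additivity. The increment along [u + v] is split
    into a leg along [v] followed by a leg along [u]; each is a mean value, and continuity of both
    derivatives brings it back to [x]. Three errors of size [e / 3] add up. *)
Lemma is_deriveDdir F (U : set V) x u v : open U -> U x ->
  (forall y, U y -> derivable F y u) -> (forall y, U y -> derivable F y v) ->
  {for x, continuous ('D_u F)} -> {for x, continuous ('D_v F)} ->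
  derivable F x (u + v) -> 'D_(u + v) F x = 'D_u F x + 'D_v F x.
Proof.
move=> oU Ux du dv cu cv dF; apply: norm_sub_eps => e e0.
have e3 : 0 < e / 3 by rewrite divr_gt0.
have [h0 h00 H] : exists2 h0 : R, 0 < h0 & forall s t : R, 0 <= s <= h0 -> 0 <= t <= h0 ->
   [set y | [/\ U y, `|'D_u F x - 'D_u F y| <= e / 3
      & `|'D_v F x - 'D_v F y| <= e / 3]] (s *: u + t *: v + x).
  apply: near_plane.
  have n1 : nbhs x U by exact: open_nbhs_nbhs.
  have n2 : \forall y \near x, `|'D_u F x - 'D_u F y| <= e / 3.
    by move/cvgrPdist_le: cu; apply.
  have n3 : \forall y \near x, `|'D_v F x - 'D_v F y| <= e / 3.
    by move/cvgrPdist_le: cv; apply.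
  by apply: filterS3 n1 n2 n3 => y; split.
have := dF => /cvgrPdist_le /(_ _ e3).
rewrite near_withinE => /nbhs_ballP [d /= d0 Hd].
pose h := Num.min h0 (d / 2).
have hp : 0 < h by rewrite lt_min h00 divr_gt0.
have hh0 : h <= h0 by rewrite ge_min lexx.
have hd : h < d by rewrite gt_min; apply/orP; right; rewrite ltr_pdivrMr // mulr_natr mulr2n ltrDl.
have {Hd} := Hd h; rewrite -ball_normE /= sub0r normrN gtr0_norm // => /(_ hd).
rewrite gt_eqF // => /(_ isT).
(* The leg from [x + h v] to [x + h (u + v)]; the next mean value covers the leg from [x] to
   [x + h v]. *)
have [|c ch Ec] := @mean_value0 (fun s => F (s *: u + (h *: v + x)))
    (fun s => 'D_u F (s *: u + (h *: v + x))) h hp.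
  move=> t /andP[t0 th]; apply: is_derive_line; apply: du.
  by rewrite addrA; have [] := H t h; rewrite ?t0 ?(le_trans th) ?(ltW hp).
have [|c' ch' Ec'] := @mean_value0 (fun s => F (s *: v + x))
    (fun s => 'D_v F (s *: v + x)) h hp.
  move=> t /andP[t0 th]; apply: is_derive_line; apply: dv.
  by have [] := H 0 t; rewrite ?t0 ?(le_trans th) ?(ltW hp) ?lexx ?(ltW h00) // scale0r add0r.
have -> : h^-1 *: (F (h *: (u + v) + x) - F x) =
    'D_u F (c *: u + (h *: v + x)) + 'D_v F (c' *: v + x).
  apply: (@mulfI _ h); first by rewrite gt_eqF.
  rewrite [h^-1 *: _]/(_ * _) mulVKf ?gt_eqF // mulrDr ![h * _]mulrC -Ec -Ec'.
  by rewrite !scale0r !add0r scalerDr -(addrA (h *: u)) subrKA.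
have [_ a1 _] : [/\ U (c *: u + h *: v + x),
   `|'D_u F x - 'D_u F (c *: u + h *: v + x)| <= e / 3 &
   `|'D_v F x - 'D_v F (c *: u + h *: v + x)| <= e / 3].
  by case/andP: ch => c0 ch; apply: H; rewrite ?c0 ?(ltW hp) ?hh0 // (le_trans ch).
have [_ _ a2] : [/\ U (0 *: u + c' *: v + x),
   `|'D_u F x - 'D_u F (0 *: u + c' *: v + x)| <= e / 3 &
   `|'D_v F x - 'D_v F (0 *: u + c' *: v + x)| <= e / 3].
  by case/andP: ch' => c0 ch'; apply: H; rewrite ?lexx ?(ltW h00) ?c0 // (le_trans ch').
move: a1 a2; rewrite !scale0r !add0r -!addrA.
rewrite /derive; move: (lim _) (lim _) (lim _) (lim _) (lim _) => A B C D G.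
rewrite !ler_norml => /andP[? ?] /andP[? ?] /andP[? ?]; apply/andP; lra.
Qed.

(* Two mean values applied to the second difference of [F] over a small parallelogram;
   exchanging [u] and [v] leaves that difference unchanged, whence Schwarz's theorem. *)
Lemma second_difference F (U : set V) x u v (h : R) : 0 < h ->
  (forall s t : R, 0 <= s <= h -> 0 <= t <= h -> U (s *: u + t *: v + x)) ->
  (forall y, U y -> derivable F y u) ->
  (forall y, U y -> derivable ('D_u F) y v) ->
  exists c d : R, [/\ 0 <= c <= h, 0 <= d <= h &
    F (h *: u + (h *: v + x)) - F (h *: v + x) - (F (h *: u + x) - F x) =
    'D_v ('D_u F) (c *: u + d *: v + x) * h * h].
Proof.
move=> hp HU du dvu.
have hh : 0 <= h <= h by rewrite ltW // lexx.
have h0 : 0 <= (0 : R) <= h by rewrite lexx ltW.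
have [|c ch Ec] := @mean_value0
   (fun s => F (s *: u + (h *: v + x)) - F (s *: u + x))
   (fun s => 'D_u F (s *: u + (h *: v + x)) - 'D_u F (s *: u + x)) h hp.
  move=> t th; apply: (@is_deriveB R R R^o); apply: is_derive_line; apply: du.
    by rewrite addrA; exact: HU.
  by have := HU t 0 th h0; rewrite scale0r addr0.
have [|d dh Ed] := @mean_value0 (fun t => 'D_u F (t *: v + (c *: u + x)))
   (fun t => 'D_v ('D_u F) (t *: v + (c *: u + x))) h hp.
  move=> t th; apply: is_derive_line; apply: dvu.
  by rewrite addrCA addrA; exact: HU.
exists c, d; split=> //.
have -> : c *: u + d *: v + x = d *: v + (c *: u + x) by rewrite -addrA addrCA.
rewrite -Ed scale0r add0r (addrCA (h *: v)) -Ec.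
by rewrite scale0r !add0r; ring.
Qed.

Lemma derive_comm F (U : set V) x u v : open U -> U x ->
  (forall y, U y -> derivable F y u) -> (forall y, U y -> derivable F y v) ->
  (forall y, U y -> derivable ('D_u F) y v) ->
  (forall y, U y -> derivable ('D_v F) y u) ->
  {for x, continuous ('D_v ('D_u F))} -> {for x, continuous ('D_u ('D_v F))} ->
  'D_v ('D_u F) x = 'D_u ('D_v F) x.
Proof.
move=> oU Ux du dv dvu duv cvu cuv; apply: norm_sub_eps => e e0.
have e2 : 0 < e / 2 by rewrite divr_gt0.
have [h h0 H] : exists2 h0 : R, 0 < h0 & forall s t : R, 0 <= s <= h0 -> 0 <= t <= h0 ->
   [set y | [/\ U y, `|'D_v ('D_u F) x - 'D_v ('D_u F) y| <= e / 2
      & `|'D_u ('D_v F) x - 'D_u ('D_v F) y| <= e / 2]] (s *: u + t *: v + x).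
  apply: near_plane.
  have n1 : nbhs x U by exact: open_nbhs_nbhs.
  have n2 : \forall y \near x, `|'D_v ('D_u F) x - 'D_v ('D_u F) y| <= e / 2.
    by move/cvgrPdist_le: cvu; apply.
  have n3 : \forall y \near x, `|'D_u ('D_v F) x - 'D_u ('D_v F) y| <= e / 2.
    by move/cvgrPdist_le: cuv; apply.
  by apply: filterS3 n1 n2 n3 => y; split.
have [||c [d [ch dh E1]]] := @second_difference F U x u v h h0 _ du.
- by move=> s t sh th; have [] := H s t sh th.
- by [].
have [||d' [c' [dh' ch' E2]]] := @second_difference F U x v u h h0 _ dv.
- by move=> s t sh th; rewrite (addrC (s *: v)); have [] := H t s th sh.
- by [].
have [_ a1 _] := H c d ch dh; have [_ _ a2] := H c' d' ch' dh'.
apply: close_trans a1 a2 _; have hn : h != 0 by rewrite gt_eqF.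
rewrite (addrC (c' *: u)); apply: quotient_eq hn E1 E2 _.
rewrite (addrCA (h *: v)).
move: (F _) (F _) (F _) (F _) => f1 f2 f3 f4; ring.
Qed.

End DirectionalDerivatives.

Section Dot.
Variables (R : realType) (n : nat).
Local Notation E := (Cspace R n).
Implicit Types (u v w : E) (c : R).

Lemma dotE u v : dot u v = \sum_i u i 0 * v i 0.
Proof. by rewrite /dot mxE; apply: eq_bigr => i _; rewrite mxE. Qed.

Lemma dotC u v : dot u v = dot v u.
Proof. by rewrite !dotE; apply: eq_bigr => i _; rewrite mulrC. Qed.

Lemma dotDl u v w : dot (u + v) w = dot u w + dot v w.
Proof. by rewrite /dot linearD mulmxDl mxE. Qed.

Lemma dotZl c u v : dot (c *: u) v = c * dot u v.
Proof. by rewrite /dot linearZ /= -scalemxAl mxE. Qed.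

Lemma dotNl u v : dot (- u) v = - dot u v.
Proof. by rewrite -scaleN1r dotZl mulN1r. Qed.

Lemma dotDr u v w : dot w (u + v) = dot w u + dot w v.
Proof. by rewrite !(dotC w) dotDl. Qed.

Lemma dotZr c u v : dot u (c *: v) = c * dot u v.
Proof. by rewrite !(dotC u) dotZl. Qed.

Lemma dotNr u v : dot u (- v) = - dot u v.
Proof. by rewrite !(dotC u) dotNl. Qed.

Lemma dot0l u : dot 0 u = 0.
Proof. by rewrite -(scale0r (0 : E)) dotZl mul0r. Qed.

Definition dotP := (dotDl, dotDr, dotZl, dotZr, dotNl, dotNr).

Lemma dot_suml (I : finType) (F : I -> E) v :
  dot (\sum_i F i) v = \sum_i dot (F i) v.
Proof. by rewrite (big_morph (fun x => dot x v) (fun x y => dotDl x y v) (dot0l v)). Qed.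

Lemma dot_ge0 u : 0 <= dot u u.
Proof. by rewrite dotE sumr_ge0 // => i _; rewrite -expr2 sqr_ge0. Qed.

Lemma dot_eq0 u : (dot u u == 0) = (u == 0).
Proof.
apply/idP/eqP => [|->]; last by rewrite dot0l.
rewrite dotE psumr_eq0 => [/allP H|i _]; last by rewrite -expr2 sqr_ge0.
apply/matrixP => i j; rewrite (ord1 j) [RHS]mxE; apply/eqP.
by have := H i (mem_index_enum i); rewrite mulf_eq0 orbb.
Qed.

Lemma dot_gt0 u : (0 < dot u u) = (u != 0).
Proof. by rewrite lt_def dot_ge0 andbT dot_eq0. Qed.

Lemma dot_delta i v : dot (delta_mx i 0) v = v i 0.
Proof.
rewrite dotE (bigD1 i) //= mxE !eqxx mul1r big1 ?addr0 // => j /negbTE ji.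
by rewrite mxE ji mul0r.
Qed.

Lemma col_sum_delta v : v = \sum_i v i 0 *: delta_mx i 0.
Proof.
apply/matrixP => i j; rewrite (ord1 j) summxE (bigD1 i) //= big1 => [|k /negbTE ki].
  by rewrite addr0 !mxE !eqxx mulr1.
by rewrite !mxE eq_sym ki mulr0.
Qed.

End Dot.

(** * The retraction x / |x| and its regularity away from 0 *)

Section RadialExtension.
Variables (R : realType) (n : nat).
Local Notation E := (Cspace R n).
Local Notation S := (sphere R n).
Local Notation U := [set x : E | x != 0].

Lemma open_neq0 : open U.
Proof.
have -> : U = (fun x : E => `|x|) @^-1` [set r | 0 < r].
  by apply/seteqP; split=> x /=; rewrite normr_gt0.
by apply: open_comp; [move=> x _; exact: norm_continuous|exact: open_gt].
Qed.

Definition invnorm (x : E) : R^o := (enorm x)^-1.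

Lemma enorm_gt0 (x : E) : (0 < enorm x) = (x != 0).
Proof. by rewrite sqrtr_gt0 dot_gt0. Qed.

Lemma is_derive_invnorm (x v : E) : x != 0 ->
  is_derive x v invnorm (- dot x v * invnorm x ^+ 3).
Proof.
move=> x0.
pose g (s : R) : R := dot v v * s ^+ 2 + 2 * dot x v * s + dot x x.
have Eg : (fun s : R => invnorm (s *: v + x)) = (fun r => r^-1) \o (Num.sqrt \o g).
  apply/funext => s /=; rewrite /invnorm /enorm /g; congr (Num.sqrt _)^-1.
  by rewrite !dotP (dotC v x); ring.
have g0 : g 0 = dot x x by rewrite /g; ring.
have dg : is_derive (0 : R) (1 : R) g (2 * dot x v).
  by apply: is_derive_eq; rewrite ?scaler0 /GRing.scale /=; ring.
have e0 : 0 < enorm x by rewrite enorm_gt0.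
have ds : is_derive (g 0 : R) (1 : R) (@Num.sqrt R) (2 * enorm x)^-1.
  by rewrite g0; apply: is_derive1_sqrt; rewrite dot_gt0.
have dgs := is_derive1_comp ds dg.
have n0 : (Num.sqrt \o g) 0 != 0 by rewrite /= g0 gt_eqF.
have di := is_deriveV n0 dgs.
apply: is_derive_line0; rewrite Eg.
apply: (is_derive_eq di); rewrite /= g0 -/(enorm x) /invnorm /GRing.scale /=.
by field; rewrite gt_eqF.
Qed.

Lemma Ck_on_dot k : Ck_on k U ((fun x : E => dot x x) : E -> R^o).
Proof.
have -> : (fun x : E => dot x x) = fun x : E => \sum_i x i 0 * x i 0.
  by apply/funext => x; rewrite dotE.
apply: Ck_on_sum open_neq0 _ => i.
by apply: (Ck_onM open_neq0); exact: Ck_on_coord.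
Qed.

(** The derivative of 1/|x| is a linear form times the cube of 1/|x|, so the induction closes using
    products alone. *)
Lemma Ck_on_invnorm k : Ck_on k U invnorm.
Proof.
have c1 x : U x -> {for x, continuous invnorm}.
  move=> x0; apply: continuousV; first by rewrite gt_eqF // enorm_gt0.
  apply: (@continuous_comp E R R (fun x => dot x x)); last exact: sqrt_continuous.
  by have [c _] := Ck_on_dot 0; exact: c.
elim: k => [|k IH]; first by split.
split=> // v; split=> [x x0|]; first by have [] := is_derive_invnorm v x0.
pose q (x : E) : R^o := \sum_i (- v i 0) * x i 0.
have Cq : Ck_on k U (q : E -> R^o).
  apply: Ck_on_sum open_neq0 _ => i; apply: (Ck_onM open_neq0).
    exact: Ck_on_cst.
  exact: Ck_on_coord.
have C3 := Ck_onM open_neq0 IH (Ck_onM open_neq0 IH IH).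
apply: Ck_on_congr (Ck_onM open_neq0 Cq C3) => //; first exact: open_neq0.
move=> x x0; have [_ ->] := is_derive_invnorm v x0.
rewrite exprS expr2; congr (_ * _).
by rewrite /q dotE -sumrN; apply: eq_bigr => i _; rewrite mulNr mulrC.
Qed.

Lemma val_neq0 (p : S) : val p != 0.
Proof. by rewrite -dot_gt0 (eqP (valP p)) ltr01. Qed.

Lemma dot_val (p : S) : dot (val p) (val p) = 1.
Proof. exact: (eqP (valP p)). Qed.

Lemma radialE (x : E) : x != 0 -> val (radial x) = invnorm x *: x.
Proof.
move=> x0; rewrite val_insubd ifT //.
have e0 : enorm x != 0 by rewrite gt_eqF // enorm_gt0.
rewrite dotZl dotZr /invnorm; apply/eqP.
have -> : dot x x = enorm x ^+ 2 by rewrite sqr_sqrtr // dot_ge0.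
by field.
Qed.

Lemma invnorm_val (p : S) : invnorm (val p) = 1.
Proof. by rewrite /invnorm /enorm dot_val sqrtr1 invr1. Qed.

Lemma radial_val (p : S) : radial (val p) = p.
Proof. by apply/val_inj; rewrite radialE ?val_neq0 // invnorm_val scale1r. Qed.

Lemma extend_val (W : Type) (f : S -> W) p : extend f (val p) = f p.
Proof. by rewrite /extend radial_val. Qed.

Lemma radial_scale (c : R) (x : E) : 0 < c -> radial (c *: x) = radial x.
Proof.
move=> c0; have [->|x0] := eqVneq x 0; first by rewrite scaler0.
apply/val_inj; rewrite !radialE ?scaler_eq0 ?negb_or ?gt_eqF //.
have e0 : enorm x != 0 by rewrite gt_eqF // enorm_gt0.
rewrite /invnorm /enorm dotZl dotZr mulrA -expr2 sqrtrM ?sqr_ge0 // sqrtr_sqr.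
by rewrite gtr0_norm // -/(enorm x) scalerA; congr (_ *: _); field; rewrite e0 gt_eqF.
Qed.

End RadialExtension.

(** * Calculus on the sphere *)

Section SphereCalculus.
Variables (R : realType) (n : nat).
Local Notation E := (Cspace R n).
Local Notation S := (sphere R n).
Local Notation F := (sfield R n).
Local Notation U := [set x : E | x != 0].
Local Notation oU := (@open_neq0 R n).
Implicit Types (f g : S -> R) (X Y Z : F) (p : S) (u v w : E).

Lemma smooth_fun_cst (c : R) : smooth_fun (fun _ : S => c).
Proof. by move=> k; exact: Ck_on_cst. Qed.

Lemma smooth_funM f g :
  smooth_fun f -> smooth_fun g -> smooth_fun (fun p => f p * g p).
Proof. by move=> sf sg k; exact: (Ck_onM oU (sf k) (sg k)). Qed.

Lemma smooth_funN f : smooth_fun f -> smooth_fun (fun p => - f p).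
Proof.
move=> sf; rewrite (_ : (fun p => - f p) = fun p => (-1) * f p).
  exact: smooth_funM (smooth_fun_cst _) sf.
by apply/funext => p; rewrite mulN1r.
Qed.

Lemma smooth_fun_sum (I : Type) (s : seq I) (f_ : I -> S -> R) :
  (forall i, smooth_fun (f_ i)) -> smooth_fun (fun p => \sum_(i <- s) f_ i p).
Proof.
move=> sf k; have C i : Ck_on k U (extend (f_ i : S -> R^o)) by exact: sf.
exact: (Ck_on_sum s xpredT oU C).
Qed.

Lemma smooth_colP X : smooth X <-> forall i, smooth_fun (fun p => X p i 0).
Proof.
split=> [sX i k|sX k].
  by move: i; apply/(Ck_on_mxP k (extend X) oU); exact: sX.
by apply/(Ck_on_mxP k (extend X) oU) => i; exact: sX.
Qed.

Lemma smooth_cst v : smooth (fun _ : S => v).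
Proof. by move=> k; exact: Ck_on_cst. Qed.

Lemma smooth_add X Y : smooth X -> smooth Y -> smooth (addf X Y).
Proof. by move=> sX sY k; exact: (Ck_onD oU (sX k) (sY k)). Qed.

Lemma smooth_scale f X : smooth_fun f -> smooth X -> smooth (scalef f X).
Proof.
move=> sf /smooth_colP sX; apply/smooth_colP => i.
rewrite (_ : (fun p => _) = fun p => f p * X p i 0); first exact: smooth_funM.
by apply/funext => p; rewrite mxE.
Qed.

Lemma smooth_metric X Y : smooth X -> smooth Y -> smooth_fun (metric X Y).
Proof.
move=> /smooth_colP sX /smooth_colP sY.
rewrite (_ : metric X Y = fun p => \sum_i X p i 0 * Y p i 0).
  by apply: smooth_fun_sum => i; exact: smooth_funM.
by apply/funext => p; rewrite /metric dotE.
Qed.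

Lemma smooth_linear (A : {linear E -> E}) X : smooth X -> smooth (fun p => A (X p)).
Proof.
move=> /smooth_colP sX; apply/smooth_colP => i.
rewrite (_ : (fun p => _) = fun p => \sum_j X p j 0 * A (delta_mx j 0) i 0).
  by apply: smooth_fun_sum => j; apply: smooth_funM => //; exact: smooth_fun_cst.
apply/funext => p; rewrite {1}(col_sum_delta (X p)) linear_sum summxE.
by apply: eq_bigr => j _; rewrite linearZ mxE.
Qed.

Definition position : F := fun p => val p.

Lemma smooth_position : smooth position.
Proof.
apply/smooth_colP => i k.
have C1 := Ck_onM oU (@Ck_on_invnorm R n k) (Ck_on_coord k U i).
apply: Ck_on_congr oU _ C1 => x x0 /=.
by rewrite /extend /position radialE // mxE.
Qed.

(** The direction is an arbitrary ambient vector, independent of any field: coordinate expansions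
    use [delta_mx i 0], which is not tangent in general. *)
Definition tder f p v : R := 'D_v (extend (f : S -> R^o)) (val p).

Lemma smooth_derivable f x v : smooth_fun f -> x != 0 ->
  derivable (extend (f : S -> R^o)) x v.
Proof. by move=> sf x0; have [_ /(_ v)[d _]] := sf 1; exact: d. Qed.

Lemma smooth_continuous_derive f x v : smooth_fun f -> x != 0 ->
  {for x, continuous ('D_v (extend (f : S -> R^o)))}.
Proof. by move=> sf x0; have [_ /(_ v)[_ [d _]]] := sf 1; exact: d. Qed.

Lemma along_col X Y p i : smooth Y ->
  along X Y p i 0 = tder (fun q => Y q i 0) p (X p).
Proof.
move=> sY; rewrite /along derive_col //.
by have [_ /(_ (X p))[d _]] := sY 1; exact/d/val_neq0.
Qed.

Lemma tder_cst (c : R) p v : tder (fun=> c) p v = 0.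
Proof. exact: derive_cst. Qed.

Lemma tderD f g p v : smooth_fun f -> smooth_fun g ->
  tder (fun q => f q + g q) p v = tder f p v + tder g p v.
Proof. by move=> sf sg; apply: deriveD; exact/smooth_derivable/val_neq0. Qed.

Lemma tderN f p v : smooth_fun f -> tder (fun q => - f q) p v = - tder f p v.
Proof. by move=> sf; apply: deriveN; exact/smooth_derivable/val_neq0. Qed.

Lemma tderM f g p v : smooth_fun f -> smooth_fun g ->
  tder (fun q => f q * g q) p v = tder f p v * g p + f p * tder g p v.
Proof.
move=> sf sg; rewrite [LHS](@deriveM _ _ (extend f) (extend g)).
- by rewrite !extend_val [RHS]addrC; congr (_ + _); rewrite mulrC.
- exact/smooth_derivable/val_neq0.
- exact/smooth_derivable/val_neq0.
Qed.

Lemma tder_sum (I : Type) (s : seq I) (f_ : I -> S -> R) p v :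
  (forall i, smooth_fun (f_ i)) ->
  tder (fun q => \sum_(i <- s) f_ i q) p v = \sum_(i <- s) tder (f_ i) p v.
Proof.
move=> sf; elim: s => [|i s IH].
  rewrite big_nil (_ : (fun q => _) = fun=> 0); first exact: tder_cst.
  by apply/funext => q; rewrite big_nil.
rewrite big_cons -IH -tderD //.
  by congr tder; apply/funext => q; rewrite big_cons.
exact: smooth_fun_sum.
Qed.

Lemma tderDv f p u v : smooth_fun f -> tder f p (u + v) = tder f p u + tder f p v.
Proof.
move=> sf; have p0 := val_neq0 p.
by apply: (@is_deriveDdir _ _ _ U _ u v oU p0);
  [move=> *; exact: smooth_derivable..|exact: smooth_continuous_derive
  |exact: smooth_continuous_derive|exact: smooth_derivable].
Qed.

Lemma tderZv f p c v : smooth_fun f -> tder f p (c *: v) = c * tder f p v.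
Proof.
move=> sf; have p0 := val_neq0 p.
by rewrite /tder; have [_ ->] := is_deriveZdir (v := v) c (smooth_derivable sf p0).
Qed.

Lemma tder0v f p : tder f p 0 = 0.
Proof. exact: derive0. Qed.

Lemma tderNv f p v : smooth_fun f -> tder f p (- v) = - tder f p v.
Proof. by move=> sf; rewrite -scaleN1r tderZv // mulN1r. Qed.

Lemma tder_expand f p v : smooth_fun f ->
  tder f p v = \sum_i v i 0 * tder f p (delta_mx i 0).
Proof.
move=> sf; rewrite {1}(col_sum_delta v).
rewrite (big_morph (tder f p) (fun x y => tderDv p x y sf) (tder0v f p)).
by apply: eq_bigr => i _; rewrite tderZv.
Qed.

(* [extend f] is homogeneous of degree 0, hence its derivatives are of degree -1. *)
Lemma derive_extend_scale f c x v : smooth_fun f -> 0 < c -> x != 0 ->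
  'D_v (extend (f : S -> R^o)) (c *: x) = c^-1 * 'D_v (extend (f : S -> R^o)) x.
Proof.
move=> sf c0 x0; apply: (@mulfI _ c); first by rewrite gt_eqF.
rewrite mulVKf ?gt_eqF //.
have cx0 : c *: x != 0 by rewrite scaler_eq0 negb_or gt_eqF.
have [_ <-] := is_deriveZdir (v := v) c (smooth_derivable sf cx0).
rewrite /derive; set G := extend _.
suff -> : (fun h => h^-1 *: ((G \o shift (c *: x)) (h *: (c *: v)) - G (c *: x))) =
  (fun h => h^-1 *: ((G \o shift x) (h *: v) - G x)) by [].
apply/funext => h /=; rewrite scalerA mulrC -scalerA -scalerDr.
by rewrite /G /extend !radial_scale.
Qed.

Lemma dot_invnorm (x : E) : x != 0 -> dot x x * invnorm x = (invnorm x)^-1.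
Proof.
move=> x0; have e0 : enorm x != 0 by rewrite gt_eqF // enorm_gt0.
have -> : dot x x = enorm x ^+ 2 by rewrite sqr_sqrtr // dot_ge0.
by rewrite /invnorm; field.
Qed.

(** The left side is homogeneous of degree 0 and the derivative of degree -1; the factor |x| makes
    up the difference. *)
Lemma extend_tder f u x : smooth_fun f -> x != 0 ->
  extend (fun q => tder f q u : R^o) x =
  (invnorm x)^-1 * 'D_u (extend (f : S -> R^o)) x.
Proof.
move=> sf x0; rewrite /extend /tder radialE // derive_extend_scale //.
by rewrite invr_gt0 enorm_gt0.
Qed.

Lemma smooth_tder f u : smooth_fun f -> smooth_fun (fun q => tder f q u).
Proof.
move=> sf k; have [_ /(_ u)[_ CD]] := sf k.+1.
(* The factor |x| is written as |x|^2 times 1/|x|, both already known to be C^k. *)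
have C1 := Ck_onM oU (Ck_onM oU (@Ck_on_dot R n k) (@Ck_on_invnorm R n k)) CD.
by apply: Ck_on_congr oU _ C1 => x x0 /=; rewrite extend_tder // -dot_invnorm.
Qed.

Lemma smooth_derivation X f : smooth X -> smooth_fun f -> smooth_fun (derivation X f).
Proof.
move=> /smooth_colP sX sf.
rewrite (_ : derivation X f = fun q => \sum_i X q i 0 * tder f q (delta_mx i 0)).
  by apply: smooth_fun_sum => i; apply: smooth_funM => //; exact: smooth_tder.
by apply/funext => q; rewrite -tder_expand.
Qed.

Lemma smooth_along X Y : smooth X -> smooth Y -> smooth (along X Y).
Proof.
move=> sX sY; apply/smooth_colP => i.
rewrite (_ : (fun p => _) = derivation X (fun q => Y q i 0)).
  by apply: smooth_derivation => //; exact: (smooth_colP _).1.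
by apply/funext => p; rewrite along_col.
Qed.

(** The extended coordinate is x_i / |x|, and at [p] the factor 1/|x| equals 1 and has derivative -
    <p, v>, which is 0 for tangent [v]. *)
Lemma tder_coord p v i : dot (val p) v = 0 -> tder (fun q => val q i 0) p v = v i 0.
Proof.
move=> pv; rewrite /tder.
have p0 := val_neq0 p.
rewrite (near_eq_derive (g := fun x : E => invnorm x * x i 0 : R^o) v).
  have [d1 d2] := is_derive_invnorm v p0.
  have [c1 c2] := is_derive_coord i (val p) v.
  rewrite [LHS](@deriveM _ _ (@invnorm R n) (fun x : E => x i 0)) // c2 d2 pv.
  by rewrite oppr0 mul0r scaler0 addr0 invnorm_val scale1r.
by apply: near_open_eq oU _ p0 => x x0; rewrite /extend radialE // mxE.
Qed.

Lemma along_position X p : dot (val p) (X p) = 0 -> along X position p = X p.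
Proof.
move=> pX; apply/matrixP => i j; rewrite (ord1 j) along_col; last exact: smooth_position.
exact: tder_coord.
Qed.

(** The factor |x| separating the extension of [tder] from the ambient derivative is stationary at
    [p] in tangent directions, so the iterated derivative is an entry of the ambient Hessian. *)
Lemma tder_tder f p u v : smooth_fun f -> dot (val p) v = 0 ->
  tder (fun q => tder f q u) p v = 'D_v ('D_u (extend (f : S -> R^o))) (val p).
Proof.
move=> sf pv; have p0 := val_neq0 p; set G := extend (f : S -> R^o).
pose N (x : E) : R^o := (invnorm x)^-1.
rewrite /tder (near_eq_derive (g := fun x : E => N x * 'D_u G x : R^o) v); last first.
  by apply: near_open_eq oU _ p0 => x x0; rewrite extend_tder.
have [d1 d2] := is_derive_invnorm v p0.
have i0 : invnorm (val p) != 0 by rewrite invnorm_val oner_neq0.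
have dN := derivableV i0 d1.
have DN : 'D_v N (val p) = 0 by rewrite deriveV // d2 pv oppr0 mul0r scaler0.
have dG : derivable ('D_u G) (val p) v.
  by have [_ /(_ u)[_ [_ /(_ v)[d _]]]] := sf 2; exact: d.
by rewrite [LHS](@deriveM _ _ N ('D_u G)) // DN scaler0 addr0 /N invnorm_val invr1 scale1r.
Qed.

End SphereCalculus.

(** * Leibniz rules, brackets and flatness of the ambient derivative on vector fields *)

Section VectorFields.
Variables (R : realType) (n : nat).
Local Notation E := (Cspace R n).
Local Notation S := (sphere R n).
Local Notation F := (sfield R n).
Implicit Types (f g : S -> R) (X Y Z : F) (p : S) (u v w : E).

Lemma eq_col u v : (forall i, u i 0 = v i 0) -> u = v.
Proof. by move=> H; apply/matrixP => i j; rewrite (ord1 j). Qed.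

Lemma smooth_fun_col X i : smooth X -> smooth_fun (fun q => X q i 0).
Proof. by move/smooth_colP. Qed.
Hint Resolve smooth_fun_col : core.

Lemma alongE X Y p : smooth Y ->
  along X Y p = \col_i tder (fun q => Y q i 0) p (X p).
Proof. by move=> sY; apply: eq_col => i; rewrite along_col // mxE. Qed.

Lemma alongD X Y Z p : smooth Y -> smooth Z ->
  along X (addf Y Z) p = along X Y p + along X Z p.
Proof.
move=> sY sZ; rewrite !alongE //; last exact: smooth_add.
apply: eq_col => i; rewrite !mxE.
rewrite (_ : (fun q => _) = fun q => Y q i 0 + Z q i 0); first by apply: tderD; auto.
by apply/funext => q; rewrite mxE.
Qed.

Lemma alongZ X f Y p : smooth_fun f -> smooth Y ->
  along X (scalef f Y) p = derivation X f p *: Y p + f p *: along X Y p.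
Proof.
move=> sf sY; rewrite !alongE //; last exact: smooth_scale.
apply: eq_col => i; rewrite !mxE.
rewrite (_ : (fun q => _) = fun q => f q * Y q i 0).
  by rewrite tderM //; auto.
by apply/funext => q; rewrite mxE.
Qed.

Lemma along_dirD X Y Z p : smooth Z ->
  along (addf X Y) Z p = along X Z p + along Y Z p.
Proof.
move=> sZ; rewrite !alongE //; apply: eq_col => i; rewrite !mxE.
exact: tderDv (smooth_fun_col i sZ).
Qed.

Lemma along_dirZ f X Z p : smooth Z ->
  along (scalef f X) Z p = f p *: along X Z p.
Proof.
move=> sZ; rewrite !alongE //; apply: eq_col => i; rewrite !mxE.
exact: tderZv (smooth_fun_col i sZ).
Qed.

Lemma derivation_metric Z X Y p : smooth X -> smooth Y ->
  derivation Z (metric X Y) p = dot (along Z X p) (Y p) + dot (X p) (along Z Y p).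
Proof.
move=> sX sY; rewrite (_ : metric X Y = fun q => \sum_i X q i 0 * Y q i 0).
  rewrite [LHS]tder_sum => [|i]; last by apply: smooth_funM; auto.
  rewrite !alongE // !dotE -big_split; apply: eq_bigr => i _.
  by rewrite !mxE tderM //; auto.
by apply/funext => q; rewrite /metric dotE.
Qed.

Lemma along_linear (A : {linear E -> E}) X Y p : smooth Y ->
  along X (fun q => A (Y q)) p = A (along X Y p).
Proof.
move=> sY; rewrite alongE; last exact: smooth_linear.
apply: eq_col => i; rewrite mxE.
rewrite [in RHS](col_sum_delta (along X Y p)) linear_sum summxE.
rewrite (_ : (fun q => _) = fun q => \sum_j A (delta_mx j 0) i 0 * Y q j 0).
  rewrite tder_sum => [|j]; last by apply: smooth_funM; auto; exact: smooth_fun_cst.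
  apply: eq_bigr => j _; rewrite linearZ mxE (alongE X p sY) mxE mulrC.
  rewrite tderM ?tder_cst ?mul0r ?add0r //; auto; exact: smooth_fun_cst.
apply/funext => q; rewrite {1}(col_sum_delta (Y q)) linear_sum summxE.
by apply: eq_bigr => j _; rewrite linearZ mxE mulrC.
Qed.

Lemma vf_smooth X : vector_field X -> smooth X. Proof. by case. Qed.
Hint Resolve vf_smooth : core.

Lemma vf_dot X p : vector_field X -> dot (val p) (X p) = 0.
Proof. by case=> _ /(_ p); rewrite tangentE => /eqP. Qed.

Lemma vf_dotr X p : vector_field X -> dot (X p) (val p) = 0.
Proof. by rewrite dotC; exact: vf_dot. Qed.

Lemma vector_fieldP X : smooth X -> (forall p, dot (val p) (X p) = 0) ->
  vector_field X.
Proof. by move=> sX tX; split=> // p; rewrite tangentE tX. Qed.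

Lemma vf_add X Y : vector_field X -> vector_field Y -> vector_field (addf X Y).
Proof.
move=> vX vY; apply: vector_fieldP => [|p]; first by apply: smooth_add; auto.
by rewrite dotDr !vf_dot ?addr0.
Qed.

Lemma vf_scale f X : smooth_fun f -> vector_field X -> vector_field (scalef f X).
Proof.
move=> sf vX; apply: vector_fieldP => [|p]; first by apply: smooth_scale; auto.
by rewrite dotZr vf_dot ?mulr0.
Qed.

Lemma subfE X Y : subf X Y = addf X (scalef (fun=> -1) Y).
Proof. by apply/funext => p; rewrite /addf /scalef scaleN1r. Qed.

Lemma vf_sub X Y : vector_field X -> vector_field Y -> vector_field (subf X Y).
Proof.
move=> vX vY; rewrite subfE; apply: vf_add => //.
by apply: vf_scale => //; exact: smooth_fun_cst.
Qed.

Lemma vf_vf_of v : vector_field (@vf_of R n v).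
Proof.
apply: vector_fieldP => [|p]; last first.
  by rewrite dotDr dotNr dotZr dot_val mulr1 dotC subrr.
rewrite (_ : vf_of v = subf (fun=> v) (scalef (metric (fun=> v) (@position R n))
   (@position R n))) // subfE; apply: smooth_add; first exact: smooth_cst.
apply: smooth_scale; first exact: smooth_fun_cst.
apply: smooth_scale (@smooth_position R n).
exact: smooth_metric (smooth_cst _) (@smooth_position R n).
Qed.

(** Differentiate <p, Y> = 0 along [X], the position having derivative [X]: this is the second
    fundamental form of the sphere. *)
Lemma dot_val_along X Y p : vector_field X -> vector_field Y ->
  dot (val p) (along X Y p) = - dot (X p) (Y p).
Proof.
move=> vX vY.
have E0 : metric (@position R n) Y = fun=> 0.
  by apply/funext => q; rewrite /metric vf_dot.
have := derivation_metric X p (@smooth_position R n) (vf_smooth vY).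
rewrite (along_position (vf_dot p vX)) E0 [LHS]tder_cst => /esym/eqP.
by rewrite addrC addr_eq0 => /eqP.
Qed.

Lemma smooth_bracket X Y : smooth X -> smooth Y -> smooth (bracket X Y).
Proof.
move=> sX sY; rewrite (_ : bracket X Y = subf (along X Y) (along Y X)) // subfE.
apply: smooth_add; first exact: smooth_along.
by apply: smooth_scale; [exact: smooth_fun_cst|exact: smooth_along].
Qed.

Lemma vf_bracket X Y : vector_field X -> vector_field Y -> vector_field (bracket X Y).
Proof.
move=> vX vY; apply: vector_fieldP => [|p]; first by apply: smooth_bracket; auto.
by rewrite dotDr dotNr !dot_val_along // (dotC (Y p)) subrr.
Qed.

(** By Leibniz, either the direction [W] is differentiated, or it is frozen at [p] and the Hessian
    of the extension remains. Only the first part survives in a commutator. *)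
Lemma derivation_derivation Z W f p :
  vector_field Z -> vector_field W -> smooth_fun f ->
  derivation Z (derivation W f) p = tder f p (along Z W p) +
    'D_(Z p) ('D_(W p) (extend (f : S -> R^o))) (val p).
Proof.
move=> vZ vW sf.
have sd i : smooth_fun (fun q => tder f q (delta_mx i 0)) by exact: smooth_tder.
have sW i : smooth_fun (fun q => W q i 0) by auto.
have -> : derivation W f = fun q => \sum_i W q i 0 * tder f q (delta_mx i 0).
  by apply/funext => q; rewrite -tder_expand.
rewrite [LHS]tder_sum => [|i]; last exact: smooth_funM.
rewrite (tder_expand p (along Z W p) sf) -tder_tder ?vf_dot //.
(* The direction is frozen at [W p] while the point [q] moves; its coordinates are then constants
   with zero derivative. *)
rewrite (_ : (fun q => tder f q (W p)) =
   fun q => \sum_i W p i 0 * tder f q (delta_mx i 0)); last first.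
  by apply/funext => q; rewrite -tder_expand.
rewrite (tder_sum _ p (Z p) (fun i => smooth_funM (smooth_fun_cst n (W p i 0)) (sd i))).
rewrite -big_split; apply: eq_bigr => i _ /=.
rewrite (tderM p (Z p) (sW i) (sd i)).
rewrite (tderM p (Z p) (smooth_fun_cst n (W p i 0)) (sd i)) tder_cst mul0r add0r.
by rewrite alongE ?mxE //; auto.
Qed.

Lemma derivation_comm X Y f p : vector_field X -> vector_field Y -> smooth_fun f ->
  derivation X (derivation Y f) p - derivation Y (derivation X f) p =
  derivation (bracket X Y) f p.
Proof.
move=> vX vY sf; rewrite !derivation_derivation //.
rewrite [RHS](tderDv p (along X Y p) (- along Y X p) sf) (tderNv _ _ sf).
rewrite opprD addrACA [X in _ + X](_ : _ = 0) ?addr0 //; apply/eqP; rewrite subr_eq0.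
have p0 := val_neq0 p.
have d1 u (y : E) : y != 0 -> derivable (extend (f : S -> R^o)) y u.
  by move=> y0; exact: smooth_derivable.
have d2 u v (y : E) : y != 0 -> derivable ('D_u (extend (f : S -> R^o))) y v.
  by move=> y0; have [_ /(_ u)[_ [_ /(_ v)[d _]]]] := sf 2; exact: d.
have d3 u v : {for val p, continuous ('D_v ('D_u (extend (f : S -> R^o))))}.
  by have [_ /(_ u)[_ [_ /(_ v)[_ [d _]]]]] := sf 2; exact: d.
apply/eqP; apply: (derive_comm (U := [set x : E | x != 0]) (@open_neq0 R n)) => //.
- by move=> y; exact: d1.
- by move=> y; exact: d1.
- by move=> y; exact: d2.
- by move=> y; exact: d2.
Qed.

Lemma along_along X Y Z p : smooth Y -> smooth Z ->
  along X (along Y Z) p = \col_i derivation X (derivation Y (fun q => Z q i 0)) p.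
Proof.
move=> sY sZ; rewrite alongE; last exact: smooth_along.
apply: eq_col => i; rewrite !mxE.
suff -> : (fun q => along Y Z q i 0) = derivation Y (fun q => Z q i 0) by [].
by apply/funext => q; rewrite alongE // mxE.
Qed.

(** Flatness of the ambient derivative, read off componentwise from [derivation_comm]; it removes
    the second derivatives from the curvature. *)
Lemma along_comm X Y Z p : vector_field X -> vector_field Y -> smooth Z ->
  along X (along Y Z) p - along Y (along X Z) p = along (bracket X Y) Z p.
Proof.
move=> vX vY sZ; rewrite !along_along; auto.
rewrite alongE //; apply: eq_col => i; rewrite !mxE.
exact: derivation_comm (smooth_fun_col i sZ).
Qed.

End VectorFields.

(** * Unitary matrices and multiplication by i on the underlying real space *)

Section Act.
Variables (R : realType) (n : nat).
Local Notation E := (Cspace R n).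
Local Notation J := (@mul_i R n).
Implicit Types (u v w : E) (s t : 'M[R[i]]_n.+1).

Lemma toC_linear (a : R) u v : toC (a *: u + v) = a%:C%C *: toC u + toC v.
Proof.
apply/matrixP => k j; rewrite !mxE; apply/eqP; rewrite eq_complex /=.
by rewrite !mul0r subr0 addr0 !eqxx.
Qed.

Lemma ofC_linear (a : R) (z w : 'cV[R[i]]_n.+1) : @ofC R n (a%:C%C *: z + w) = a *: ofC z + ofC w.
Proof. by apply: (can_inj (@toCK R n)); rewrite toC_linear !ofCK. Qed.

Lemma ofCZ (a : R) (z : 'cV[R[i]]_n.+1) : @ofC R n (a%:C%C *: z) = a *: ofC z.
Proof.
rewrite -[_ *: z]addr0 ofC_linear -[RHS]addr0; congr (_ + _).
have := ofC_linear 1 0 0; rewrite !scale1r addr0 => /(congr1 (fun v => v - @ofC R n 0)).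
by rewrite subrr addrK.
Qed.

Fact act_is_linear s : linear (@act R n s).
Proof.
by move=> a u v; rewrite /act toC_linear mulmxDr -scalemxAr ofC_linear.
Qed.
HB.instance Definition _ s := GRing.isLinear.Build R E E *:%R (act s) (act_is_linear s).

Lemma actD s u v : act s (u + v) = act s u + act s v. Proof. exact: linearD. Qed.

Lemma actZ s (a : R) u : act s (a *: u) = a *: act s u. Proof. exact: linearZ. Qed.

Lemma actN s u : act s (- u) = - act s u. Proof. exact: linearN. Qed.

Lemma actM s t u : act s (act t u) = act (s *m t) u.
Proof. by rewrite /act ofCK mulmxA. Qed.

Lemma act1 u : act 1%:M u = u.
Proof. by rewrite /act mul1mx toCK. Qed.

(** Seen as the action of a scalar unitary matrix, multiplication by i inherits linearity, isometry
    and commutation with [act s]. *)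
Lemma mul_iE u : J u = act 'i%C%:M u.
Proof. by rewrite /mul_i /act mul_scalar_mx. Qed.

Fact mul_i_is_linear : linear J.
Proof. by move=> a u v; rewrite !mul_iE linearP. Qed.
HB.instance Definition _ := GRing.isLinear.Build R E E *:%R J mul_i_is_linear.

Lemma mul_iD u v : J (u + v) = J u + J v. Proof. exact: linearD. Qed.

Lemma mul_iZ (a : R) u : J (a *: u) = a *: J u. Proof. exact: linearZ. Qed.

Lemma act_mul_i s u : act s (J u) = J (act s u).
Proof. by rewrite !mul_iE !actM scalar_mxC. Qed.

Lemma mul_iK u : J (J u) = - u.
Proof.
rewrite !mul_iE actM -scalar_mxM.
have -> : ('i * 'i)%C = (-1)%:C%C :> R[i].
  by apply/eqP; rewrite eq_complex /= !(mul0r, mul1r, mulr0, sub0r, addr0) !eqxx.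
by rewrite /act mul_scalar_mx ofCZ toCK scaleN1r.
Qed.

(** [dot_toC] identifies only norms with the hermitian product, so products are recovered by
    polarisation. *)
Lemma dot_act s u v : s \is unitarymx -> dot (act s u) (act s v) = dot u v.
Proof.
move=> us.
have N w : dot (act s w) (act s w) = dot w w.
  apply: (@complexI R); rewrite -!dot_toC ofCK map_mxM trmx_mul -mulmxA.
  rewrite [X in _ *m X]mulmxA.
  suff -> : (map_mx conjc s)^T *m s = 1%:M by rewrite mul1mx.
  by apply: mulmx1C; rewrite map_trmx; apply/unitarymxP.
have D (x y : E) : dot (x + y) (x + y) = dot x x + dot y y + 2 * dot x y.
  by rewrite dotDl !dotDr (dotC y x); ring.
have E : dot (act s u + act s v) (act s u + act s v) = dot (u + v) (u + v).
  exact: etrans (congr1 (fun z => dot z z) (esym (actD s u v))) (N (u + v)).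
have C (a a' b b' c c' : R) :
    a = a' -> b = b' -> a + b + 2 * c = a' + b' + 2 * c' -> c = c' by lra.
exact: C (N u) (N v) (etrans (esym (D _ _)) (etrans E (D u v))).
Qed.

Lemma dot_mul_i u v : dot (J u) (J v) = dot u v.
Proof.
rewrite !mul_iE dot_act //; apply/unitarymxP.
rewrite tr_scalar_mx map_scalar_mx -scalar_mxM; congr (_%:M).
by apply/eqP; rewrite eq_complex /= !(mul0r, mul1r, mulr0, sub0r, addr0, opprK) !eqxx.
Qed.

Lemma dot_mul_il u v : dot (J u) v = - dot u (J v).
Proof. by rewrite -[LHS]dot_mul_i mul_iK dotNl. Qed.

Definition cspace_hermitian : hermitian_space (Cspace R n : lmodType R) :=
  @HermitianSpace R (Cspace R n : lmodType R) (@dot R n) J (@dotC R n)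
    (fun u H => eqP (etrans (esym (dot_eq0 u)) (introT eqP H)))
    (@dotDl R n) (@dotZl R n) mul_iD mul_iZ mul_iK dot_mul_i.

End Act.

(** * The connections and their curvature *)

Section Connections.
Variables (R : realType) (n : nat).
Local Notation E := (Cspace R n).
Local Notation S := (sphere R n).
Local Notation F := (sfield R n).
Local Notation J := (@mul_i R n).
Implicit Types (f g : S -> R) (X Y Z : F) (p : S) (u v w x y z q : E) (r c : R).
Hint Resolve vf_smooth : core.

Local Notation herm := (cspace_hermitian R n).
Local Notation sform := (cform herm).

Definition sasaki_connection r : connection R n :=
  fun X Y p => along X Y p + sform r (val p) (X p) (Y p).

Lemma dot_val_cform r p x y : dot (val p) (sform r (val p) x y) = dot x y.
Proof. exact: (ip_base_cform (H := herm) r x y (dot_val p)). Qed.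

Definition jfield X : F := fun p => J (X p).

Lemma smooth_jfield X : smooth X -> smooth (jfield X).
Proof. exact: smooth_linear. Qed.

Lemma along_jfield W X p : smooth X -> along W (jfield X) p = J (along W X p).
Proof. exact: along_linear. Qed.

Lemma cform_field r Z X Y :
  (fun p => sform r (Z p) (X p) (Y p)) =
  addf (scalef (metric X Y) Z)
    (scalef (fun=> r)
      (addf (addf (scalef (fun p => - metric X (jfield Y) p) (jfield Z))
                  (scalef (fun=> -1) (scalef (metric (jfield X) Z) (jfield Y))))
            (scalef (metric (jfield Y) Z) (jfield X)))).
Proof. by apply/funext => p; rewrite /addf /scalef scaleN1r. Qed.

Lemma smooth_cform r X Y Z : smooth X -> smooth Y -> smooth Z ->
  smooth (fun p => sform r (Z p) (X p) (Y p)).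
Proof.
move=> sX sY sZ; have sJX := smooth_jfield sX; have sJY := smooth_jfield sY.
have sJZ := smooth_jfield sZ; rewrite cform_field.
apply: smooth_add; first exact: smooth_scale (smooth_metric sX sY) sZ.
apply: smooth_scale; first exact: smooth_fun_cst.
apply: smooth_add; last exact: smooth_scale (smooth_metric sJY sZ) sJX.
apply: smooth_add; first exact: smooth_scale (smooth_funN (smooth_metric sX sJY)) sJZ.
apply: smooth_scale; first exact: smooth_fun_cst.
exact: smooth_scale (smooth_metric sJX sZ) sJY.
Qed.

(* Stated for arbitrary fields in place of [jfield X], [jfield Y], [jfield Z]
   so that no conversion check unfolds the complex structure. *)
Lemma along_cform_expand r (W X Y Z JX JY JZ : F) p (a b c : E) :
  smooth X -> smooth Y -> smooth Z -> smooth JX -> smooth JY -> smooth JZ ->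
  along W JX p = a -> along W JY p = b -> along W JZ p = c ->
  along W (addf (scalef (metric X Y) Z)
    (scalef (fun=> r)
      (addf (addf (scalef (fun p => - metric X JY p) JZ)
                  (scalef (fun=> -1) (scalef (metric JX Z) JY)))
            (scalef (metric JY Z) JX)))) p =
  (dot (along W X p) (Y p) + dot (X p) (along W Y p)) *: Z p
  + dot (X p) (Y p) *: along W Z p
  + (0 *: addf (addf (scalef (fun p => - metric X JY p) JZ)
                  (scalef (fun=> -1) (scalef (metric JX Z) JY)))
            (scalef (metric JY Z) JX) p
  + r *: (- (dot (along W X p) (JY p) + dot (X p) b) *: JZ p
    + - dot (X p) (JY p) *: c
    + (0 *: (scalef (metric JX Z) JY) p
      + -1 *: ((dot a (Z p) + dot (JX p) (along W Z p)) *: JY p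
      + dot (JX p) (Z p) *: b))
    + ((dot b (Z p) + dot (JY p) (along W Z p)) *: JX p + dot (JY p) (Z p) *: a))).
Proof.
move=> sX sY sZ sJX sJY sJZ ea eb ec.
have s1 := smooth_scale (smooth_metric sX sY) sZ.
have s2 := smooth_scale (smooth_funN (smooth_metric sX sJY)) sJZ.
have s3 := smooth_scale (smooth_metric sJX sZ) sJY.
have s4 := smooth_scale (smooth_metric sJY sZ) sJX.
have sN := smooth_scale (smooth_fun_cst n (-1)) s3.
have s5 := smooth_add s2 sN.
have s6 := smooth_add s5 s4.
have s7 := smooth_scale (smooth_fun_cst n r) s6.
rewrite (alongD _ _ s1 s7) (alongZ _ _ (smooth_metric sX sY) sZ).
rewrite (alongZ _ _ (smooth_fun_cst n r) s6) (alongD _ _ s5 s4).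
rewrite (alongD _ _ s2 sN) (alongZ _ _ (smooth_funN (smooth_metric sX sJY)) sJZ).
rewrite (alongZ _ _ (smooth_fun_cst n (-1)) s3) (alongZ _ _ (smooth_metric sJX sZ) sJY).
rewrite (alongZ _ _ (smooth_metric sJY sZ) sJX) ea eb ec.
have eN : derivation W (fun o => - metric X JY o) p = - derivation W (metric X JY) p.
  exact: tderN (smooth_metric sX sJY).
rewrite eN !derivation_metric // ea eb.
by rewrite [derivation W (fun=> r) p]tder_cst [derivation W (fun=> -1) p]tder_cst.
Qed.

Lemma along_cform r W X Y Z p : smooth X -> smooth Y -> smooth Z ->
  along W (fun p => sform r (Z p) (X p) (Y p)) p =
  sform r (along W Z p) (X p) (Y p) + sform r (Z p) (along W X p) (Y p)
   + sform r (Z p) (X p) (along W Y p).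
Proof.
move=> sX sY sZ; rewrite cform_field.
apply: etrans (along_cform_expand r sX sY sZ (smooth_jfield sX) (smooth_jfield sY)
  (smooth_jfield sZ) (along_jfield W p sX) (along_jfield W p sY) (along_jfield W p sZ)) _.
exact: (cform_leibniz herm r (Z p) (along W Z p) (X p) (along W X p) (Y p) (along W Y p)).
Qed.

Lemma vf_sasaki r X Y : vector_field X -> vector_field Y ->
  vector_field (sasaki_connection r X Y).
Proof.
move=> vX vY; apply: vector_fieldP => [|p].
  apply: smooth_add; first by apply: smooth_along; auto.
  exact: (smooth_cform r (vf_smooth vX) (vf_smooth vY) (@smooth_position R n)).
by rewrite dotDr dot_val_along // dot_val_cform addNr.
Qed.

Lemma sasaki_is_connection r : is_connection (sasaki_connection r).
Proof.
split.
- exact: vf_sasaki.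
- move=> X X' Y vX vX' vY; apply/funext => p.
  rewrite /addf /sasaki_connection (along_dirD X X' p (vf_smooth vY)).
  rewrite [RHS]addrACA; congr (_ + _); exact: (cformDl herm).
- move=> f X Y sf vX vY; apply/funext => p.
  rewrite /scalef /sasaki_connection (along_dirZ f X p (vf_smooth vY)).
  rewrite [RHS]scalerDr; congr (_ + _); exact: (cformZl herm).
- move=> X Y Y' vX vY vY'; apply/funext => p.
  rewrite /sasaki_connection (alongD X p (vf_smooth vY) (vf_smooth vY')).
  rewrite [RHS]addrACA; congr (_ + _); exact: (cformDr herm).
- move=> f X Y sf vX vY; apply/funext => p.
  rewrite /sasaki_connection (alongZ X p sf (vf_smooth vY)).
  rewrite -[LHS]addrA [X in _ = _ + X]scalerDr; congr (_ + (_ + _)); exact: (cformZr herm).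
Qed.

Lemma sasaki_is_metric r : is_metric (sasaki_connection r).
Proof.
move=> X Y Z vX vY vZ p; rewrite derivation_metric; auto.
rewrite /metric /sasaki_connection dotDl dotDr addrACA.
have -> := @cform_skew _ _ herm r (val p) (X p) (Y p) (Z p) (vf_dotr p vY) (vf_dotr p vZ).
by rewrite addr0.
Qed.

Lemma sasaki_torsion r X Y p :
  torsion (sasaki_connection r) X Y p = tform herm (2 * r) (val p) (X p) (Y p).
Proof.
rewrite -cform_torsion; exact: sub_add_sub.
Qed.

Lemma sasaki_has_skew_torsion r : has_skew_torsion (sasaki_connection r).
Proof.
have H X Y Z p : metric (torsion (sasaki_connection r) X Y) Z p =
    dot (tform herm (2 * r) (val p) (X p) (Y p)) (Z p).
  by rewrite /metric sasaki_torsion.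
split.
- move=> X Y Z vX vY vZ; apply: smooth_metric; auto.
  rewrite /torsion; have vXY := vf_sasaki r vX vY; have vYX := vf_sasaki r vY vX.
  by apply/vf_smooth/vf_sub; [exact: vf_sub|exact: vf_bracket].
- move=> X X' Y Z vX vX' vY vZ p.
  apply: etrans (H (addf X X') Y Z p) _.
  apply: etrans (congr2 +%R (esym (H X Y Z p)) (esym (H X' Y Z p))).
  exact: etrans (congr1 (fun v => dot v (Z p)) (tformDl herm _ _ _ _ _)) (dotDl _ _ _).
- move=> f X Y Z sf vX vY vZ p.
  apply: etrans (H (scalef f X) Y Z p) _.
  apply: etrans (congr1 ( *%R (f p)) (esym (H X Y Z p))).
  exact: etrans (congr1 (fun v => dot v (Z p)) (tformZl herm _ _ _ _ _)) (dotZl _ _ _).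
- move=> X Y Z vX vY vZ p.
  apply: etrans (H Y X Z p) (etrans _ (congr1 -%R (esym (H X Y Z p)))).
  exact: (tformC herm).
- move=> X Y Z vX vY vZ p.
  apply: etrans (H X Z Y p) (etrans _ (congr1 -%R (esym (H X Y Z p)))).
  exact: (@tform_skew _ _ herm _ _ _ _ _ (vf_dotr p vY) (vf_dotr p vZ)).
Qed.

Lemma bracket_torsion_free X Y p : torsion (sasaki_connection 0) X Y p = 0.
Proof.
rewrite sasaki_torsion /tform mulr0 cform0; exact: subrr.
Qed.

Lemma sasaki0_is_levi_civita : is_levi_civita (sasaki_connection 0).
Proof.
split; [exact: sasaki_is_connection|exact: sasaki_is_metric|].
by move=> X Y _ _ p; exact: bracket_torsion_free.
Qed.

Definition cdiff (N N' : connection R n) X Y : F := subf (N X Y) (N' X Y).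

Lemma vf_cdiff N N' X Y : is_connection N -> is_connection N' ->
  vector_field X -> vector_field Y -> vector_field (cdiff N N' X Y).
Proof. by case=> c _ _ _ _ [c' _ _ _ _] vX vY; apply: vf_sub; [exact: c|exact: c']. Qed.

Lemma cdiff_skew N N' X Y Z p : is_metric N -> is_metric N' ->
  vector_field X -> vector_field Y -> vector_field Z ->
  metric (cdiff N N' X Z) Y p = - metric (cdiff N N' X Y) Z p.
Proof.
move=> m m' vX vY vZ; apply: (@ip_sub_skew _ _ herm).
exact: etrans (esym (m X Y Z vX vY vZ p)) (m' X Y Z vX vY vZ p).
Qed.

Lemma cdiff_torsion N N' X Y p :
  cdiff N N' X Y p - cdiff N N' Y X p = torsion N X Y p - torsion N' X Y p.
Proof. exact: sub_torsion. Qed.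

(** The difference of the two connections is symmetric because both are torsion-free, and skew in
    its last two arguments because both are metric. The braid argument is applied with the
    difference field [D] as third argument, giving |D|^2 = 0. *)
Lemma levi_civita_unique N X Y : is_levi_civita N ->
  vector_field X -> vector_field Y -> N X Y = sasaki_connection 0 X Y.
Proof.
case=> c m t vX vY; have [c' m' t'] := sasaki0_is_levi_civita.
have vD := vf_cdiff c c' vX vY; set D := cdiff _ _ X Y in vD.
have S X' Y' Z' p : vector_field X' -> vector_field Y' ->
    metric (cdiff N (sasaki_connection 0) X' Y') Z' p =
    metric (cdiff N (sasaki_connection 0) Y' X') Z' p.
  move=> vX' vY'; apply: (congr1 (fun v => dot v (Z' p))).
  apply/eqP; rewrite -subr_eq0; apply/eqP/(etrans (cdiff_torsion _ _ _ _ _)).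
  by rewrite t // t' // subrr.
have K X' Y' Z' p := @cdiff_skew _ _ X' Y' Z' p m m'.
apply/funext => p; apply/eqP; rewrite -subr_eq0 -dot_eq0; apply/eqP.
exact: (braid0 (S X Y D p vX vY) (K Y D X p vY vD vX) (S Y D X p vY vD)
  (K D X Y p vD vX vY) (S D X Y p vD vX) (K X Y D p vX vY vD)).
Qed.

End Connections.

(** * Curvature of the model, and transfer between connections equal on vector fields *)

Section Curvature.
Variables (R : realType) (n : nat).
Local Notation E := (Cspace R n).
Local Notation S := (sphere R n).
Local Notation F := (sfield R n).
Local Notation herm := (cspace_hermitian R n).
Implicit Types (f g : S -> R) (X Y Z : F) (p : S) (u v w x y z q : E) (r c : R).

Lemma sasaki_curvature r X Y Z p :
  vector_field X -> vector_field Y -> vector_field Z ->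
  curvature (sasaki_connection r) X Y Z p = curv herm r (val p) (X p) (Y p) (Z p).
Proof.
move=> vX vY vZ; have sX := vf_smooth vX; have sY := vf_smooth vY.
have sZ := vf_smooth vZ.
have D (V W : F) : vector_field V -> smooth W ->
   along V (sasaki_connection r W Z) p = along V (along W Z) p +
    (cform herm r (V p) (W p) (Z p) + cform herm r (val p) (along V W p) (Z p)
     + cform herm r (val p) (W p) (along V Z p)).
  move=> vV sW; have sC := smooth_cform r sW sZ (@smooth_position R n).
  apply: etrans (alongD V p (smooth_along sW sZ) sC) _; congr (_ + _).
  apply: etrans (along_cform r V p sW sZ (@smooth_position R n)) _.
  by rewrite (along_position (vf_dot p vV)).
apply: etrans (curv_expand herm r (val p) (X p) (Y p) (Z p)
  (along X (along Y Z) p) (along Y (along X Z) p) (along X Y p) (along Y X p)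
  (along X Z p) (along Y Z p)).
pose sub2 (a b c : E) := a - b - c.
have E1 := congr1 (fun v => v + cform herm r (val p) (X p) (sasaki_connection r Y Z p)) (D X Y vX sY).
have E2 := congr1 (fun v => v + cform herm r (val p) (Y p) (sasaki_connection r X Z p)) (D Y X vY sX).
have E3 := congr1 (fun v => v + cform herm r (val p) (bracket X Y p) (Z p))
  (esym (along_comm p vX vY sZ)).
exact: (f_equal3 sub2 E1 E2 E3).
Qed.

Lemma vf_curvature (N : connection R n) X Y Z : is_connection N ->
  vector_field X -> vector_field Y -> vector_field Z -> vector_field (curvature N X Y Z).
Proof.
case=> c _ _ _ _ vX vY vZ; have cXZ := c _ _ vX vZ; have cYZ := c _ _ vY vZ.
apply: vf_sub; last exact: c (vf_bracket vX vY) vZ.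
by apply: vf_sub; exact: c.
Qed.

(** Plain equality would be too strong: the axioms leave a connection free on maps that are not
    smooth tangent fields. *)
Definition agree (N N' : connection R n) :=
  forall X Y, vector_field X -> vector_field Y -> N X Y = N' X Y.

Section Agree.
Variables (N N' : connection R n).
Hypothesis NN' : agree N N'.

Lemma agree_connection : is_connection N' -> is_connection N.
Proof.
case=> c1 c2 c3 c4 c5; split.
- by move=> X Y vX vY; rewrite NN' //; exact: c1.
- by move=> X X' Y vX vX' vY; rewrite !NN' ?c2 //; exact: vf_add.
- by move=> f X Y sf vX vY; rewrite !NN' ?c3 //; exact: vf_scale.
- by move=> X Y Y' vX vY vY'; rewrite !NN' ?c4 //; exact: vf_add.
- by move=> f X Y sf vX vY; rewrite !NN' ?c5 //; exact: vf_scale.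
Qed.

Lemma agree_metric : is_metric N' -> is_metric N.
Proof. by move=> m X Y Z vX vY vZ p; rewrite !NN' //; exact: m. Qed.

Lemma agree_torsion X Y : vector_field X -> vector_field Y ->
  torsion N X Y = torsion N' X Y.
Proof. by move=> vX vY; rewrite /torsion !NN'. Qed.

Lemma agree_skew_torsion : has_skew_torsion N' -> has_skew_torsion N.
Proof.
case=> t1 t2 t3 t4 t5; split.
- by move=> X Y Z vX vY vZ; rewrite agree_torsion //; exact: t1.
- move=> X X' Y Z vX vX' vY vZ p; rewrite !agree_torsion //; last exact: vf_add.
  exact: t2.
- move=> f X Y Z sf vX vY vZ p; rewrite !agree_torsion //; last exact: vf_scale.
  exact: t3.
- by move=> X Y Z vX vY vZ p; rewrite !agree_torsion //; exact: t4.
- by move=> X Y Z vX vY vZ p; rewrite !agree_torsion //; exact: t5.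
Qed.

(** Curvature iterates the connection, so the inner derivatives must be vector fields again; this is
    what the assumption on [N'] provides. *)
Lemma agree_curvature X Y Z : is_connection N' ->
  vector_field X -> vector_field Y -> vector_field Z ->
  curvature N X Y Z = curvature N' X Y Z.
Proof.
case=> c _ _ _ _ vX vY vZ; have vB := vf_bracket vX vY.
have vYZ := c _ _ vY vZ; have vXZ := c _ _ vX vZ.
by rewrite /curvature (NN' vY vZ) (NN' vX vZ) !NN'.
Qed.

Lemma agree_ricci Y Z p : is_connection N' -> vector_field Y -> vector_field Z ->
  ricci N Y Z p = ricci N' Y Z p.
Proof.
move=> c vY vZ; apply: eq_bigr => i _.
by rewrite agree_curvature //; exact: vf_vf_of.
Qed.

Lemma agree_scalar p : is_connection N' -> scalar_curvature N p = scalar_curvature N' p.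
Proof.
move=> c; apply: eq_bigr => i _; apply: eq_bigr => j _.
by rewrite agree_ricci //; exact: vf_vf_of.
Qed.

End Agree.

Lemma nabla_r_agree nablag r : is_levi_civita nablag ->
  agree (nabla_r nablag r) (sasaki_connection r).
Proof.
move=> lc X Y vX vY; apply/funext => p.
rewrite /nabla_r (levi_civita_unique lc vX vY) /sasaki_connection -addrA; congr (_ + _).
rewrite -(cform_sasaki (H := herm) r (Y p) (vf_dotr p vX)) cform0.
by [].
Qed.

End Curvature.

(** * Tangent frames, Ricci tensor and scalar curvature *)

Section Ricci.
Variables (R : realType) (n : nat).
Local Notation E := (Cspace R n).
Local Notation S := (sphere R n).
Local Notation F := (sfield R n).
Local Notation herm := (cspace_hermitian R n).
Implicit Types (X Y Z : F) (p : S) (u v w x y z q : E) (r c : R).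

(** Rank-nullity for the functional v -> <p, v>, which is nonzero because it takes the value 1 at
    [p]. *)
Lemma dim_tangent p : \dim (tangent p) = (2 * n + 1)%N.
Proof.
have := limg_ker_dim (linfun (mulmx (val p)^T : E -> 'M[R]_1)) fullv.
rewrite capfv -/(tangent p) dimvf.
set f := linfun _.
have -> : \dim (f @: fullv) = 1%N.
  apply/eqP; rewrite eqn_leq; apply/andP; split.
    by have := dimvS (subvf (f @: fullv)%VS); rewrite dimvf /dim /= muln1.
  rewrite lt0n dimv_eq0; apply/negP => /eqP f0.
  have : f (val p) \in (f @: fullv)%VS by apply: memv_img; exact: memvf.
  rewrite f0 memv0 lfunE /= => /eqP e.
  by have := dot_val p; rewrite /dot e mxE => /esym/eqP; rewrite oner_eq0.
move: (\dim (tangent p)) => d.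
rewrite -[dim _]/((n.+1 + n.+1) * 1)%N.
by rewrite muln1 addn1 addnS addSn addnn mul2n addn1 => -[].
Qed.

Section Frame.
Variable p : S.
Local Notation m := (\dim (tangent p)).
Let b (i : 'I_m) : E := (vbasis (tangent p))`_i.
Let gram : 'M[R]_m := \matrix_(i, j) dot (b i) (b j).

Lemma frame_tangent i : b i \in tangent p.
Proof. by apply: vbasis_mem; rewrite mem_nth // size_tuple. Qed.

Lemma frame_dot i : dot (b i) (val p) = 0.
Proof. by have := frame_tangent i; rewrite tangentE dotC => /eqP. Qed.

Lemma tangent_expand v : v \in tangent p ->
  v = \sum_i coord (vbasis (tangent p)) i v *: b i.
Proof. exact: coord_vbasis. Qed.

(** A kernel vector gives a combination [w] of the frame orthogonal to every frame vector, hence to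
    itself. *)
Lemma gram_unit : gram \in unitmx.
Proof.
rewrite -row_free_unit -kermx_eq0; apply/rowV0P => v /sub_kermxP vG.
pose w := \sum_i v 0 i *: b i.
have wb k : dot w (b k) = 0.
  have := congr1 (fun M : 'rV[R]_m => M 0 k) vG; rewrite !mxE => <-.
  by rewrite dot_suml; apply: eq_bigr => i _; rewrite dotZl mxE.
have w0 : w = 0.
  apply/eqP; rewrite -dot_eq0 {2}/w dotC dot_suml big1 // => i _.
  by rewrite dotZl dotC wb mulr0.
have /freeP fr := basis_free (vbasisP (tangent p)).
by apply/matrixP => i j; rewrite (ord1 i) fr ?mxE //.
Qed.

Let g := invmx gram.

Lemma gram_invC i j : g i j = g j i.
Proof.
have e : gram^T = gram by apply/matrixP => k l; rewrite !mxE dotC.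
by rewrite -[in LHS](trmxK g) mxE /g trmx_inv e.
Qed.

Lemma gram_invK i k : \sum_j g i j * dot (b j) (b k) = (i == k)%:R.
Proof.
have := congr1 (fun M : 'M[R]_m => M i k) (mulVmx gram_unit).
by rewrite !mxE => <-; apply: eq_bigr => j _; rewrite mxE.
Qed.

Lemma coord_dual i v : v \in tangent p ->
  coord (vbasis (tangent p)) i v = dual herm b g i v.
Proof.
move=> /tangent_expand e; rewrite [in RHS]e dual_sum (bigD1 i) //= big1 => [|k ki].
  by rewrite addr0 [X in _ * X]gram_invK eqxx mulr1.
by rewrite [X in _ * X]gram_invK eq_sym (negbTE ki) mulr0.
Qed.

Lemma tangent_span v : dot v (val p) = 0 -> v = \sum_i dual herm b g i v *: b i.
Proof.
move=> vp; have vt : v \in tangent p by rewrite tangentE dotC vp.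
by rewrite {1}(tangent_expand vt); apply: eq_bigr => i _; rewrite coord_dual.
Qed.

Lemma sasaki_ricci r Y Z : vector_field Y -> vector_field Z ->
  ricci (sasaki_connection r) Y Z p =
  2 * (n%:R - r ^+ 2) * metric Y Z p - 2 * (n%:R - 1) * r ^+ 2 * (eta Y p * eta Z p).
Proof.
move=> vY vZ; rewrite /ricci /trace_on.
have c := @sasaki_is_connection R n r.
have T i : curvature (sasaki_connection r) (vf_of (b i)) Y Z p =
   curv herm r (val p) (b i) (Y p) (Z p).
  apply: etrans (sasaki_curvature r p (@vf_vf_of R n (b i)) vY vZ) _.
  by rewrite vf_of_id // frame_tangent.
(* [coord] and [dual] are known to coincide on tangent vectors only. *)
have Tt i : curv herm r (val p) (b i) (Y p) (Z p) \in tangent p.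
  rewrite -T; have [_ t] := vf_curvature c (@vf_vf_of R n (b i)) vY vZ; exact: t.
rewrite (eq_bigr (fun i => dual herm b g i (curv herm r (val p) (b i) (Y p) (Z p)))).
  apply: etrans (trace_curv (H := herm) (dot_val p) frame_dot gram_invC gram_invK tangent_span r
     (vf_dotr p vY) (vf_dotr p vZ)) _.
  (* With m = 2n + 1, the coefficients m - 1 - 2 r^2 and m - 3 become 2 (n - r^2) and 2 (n - 1). The
     sign in [eE] disappears in the product of two eta terms. *)
  rewrite dim_tangent natrD natrM.
  have eE X : eta X p = - ip herm (X p) (jj herm (val p)) by exact: dot_mul_il.
  rewrite !eE mulrNN -[ip herm (Y p) (Z p)]/(metric Y Z p).
  move: (ip _ _ _) (ip _ _ _) (metric _ _ _) => e1 e2 e3; ring.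
by move=> i _; rewrite T coord_dual.
Qed.

(** The metric has trace 2n + 1 and the square of eta has trace |i p|^2 = 1, so the r^2 terms add up
    to -2 (2n + 1) - 2 (n - 1) = -6n. *)
Lemma sasaki_scalar r : scalar_curvature (sasaki_connection r) p =
  2 * n%:R * (2 * n%:R + 1) - 6 * n%:R * r ^+ 2.
Proof.
rewrite /scalar_curvature /gtrace.
pose e i := ip herm (b i) (jj herm (val p)).
rewrite (eq_bigr (fun i => 2 * (n%:R - r ^+ 2) * (\sum_j g i j * dot (b i) (b j)) -
   2 * (n%:R - 1) * r ^+ 2 * (\sum_j g i j * (e i * e j)))); last first.
  move=> i _; rewrite !mulr_sumr -sumrB; apply: eq_bigr => j _.
  apply: etrans (congr1 ( *%R (g i j)) (sasaki_ricci r (@vf_vf_of R n (b i)) (@vf_vf_of R n (b j)))) _.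
  have eE k : eta (vf_of (b k)) p = - e k.
    by rewrite /eta vf_of_id ?frame_tangent //; exact: dot_mul_il.
  by rewrite !eE /metric !vf_of_id ?frame_tangent //; ring.
rewrite sumrB -!mulr_sumr.
rewrite [X in _ * X - _](trace_metric (H := herm) gram_invK).
have eq0 : ip herm (jj herm (val p)) (val p) = 0 by rewrite ip_jjl ip_jj_self oppr0.
rewrite [X in _ - _ * X](trace_square (dot_val p : ip herm _ _ = _) frame_dot tangent_span eq0).
by rewrite ip_jj [ip _ _ _](dot_val p) dim_tangent natrD natrM; ring.
Qed.

End Frame.

End Ricci.

(** * Equivariance of the calculus and of the model connections under unitary matrices *)

Section Invariance.
Variables (R : realType) (n : nat).
Local Notation E := (Cspace R n).
Local Notation S := (sphere R n).
Local Notation F := (sfield R n).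
Local Notation herm := (cspace_hermitian R n).
Local Notation oU := (@open_neq0 R n).
Implicit Types (X Y Z : F) (p : S) (u v w x y z q : E) (r c : R).
Implicit Types (s t : 'M[R[i]]_n.+1).

Lemma continuous_linear_col (A : {linear E -> E}) : continuous A.
Proof.
move=> x; apply/continuous_mxP => i.
have C j : Ck_on 0 setT (fun y : E => y j 0 * A (delta_mx j 0) i 0 : R^o).
  by apply: (Ck_onM openT); [exact: Ck_on_coord|exact: Ck_on_cst].
have [cS _] := Ck_on_sum (index_enum _) xpredT openT C.
rewrite (_ : (fun y : E => A y i 0) = fun y => \sum_j y j 0 * A (delta_mx j 0) i 0).
  exact: cS.
apply/funext => y; rewrite {1}(col_sum_delta y) linear_sum summxE.
by apply: eq_bigr => j _; rewrite linearZ mxE.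
Qed.

Lemma derive_comp_linear (W : normedModType R) (A : {linear E -> E}) (G : E -> W) x v :
  (fun h : R => h^-1 *: (((fun y => G (A y)) \o shift x) (h *: v) - G (A x))) =
  (fun h : R => h^-1 *: ((G \o shift (A x)) (h *: A v) - G (A x))).
Proof. by apply/funext => h /=; rewrite (linearP A). Qed.

Lemma derive_linear_comp (W : normedModType R) (A : {linear E -> E}) (G : E -> W) x v :
  'D_v (fun y => G (A y)) x = 'D_(A v) G (A x).
Proof. by rewrite /derive derive_comp_linear. Qed.

Lemma Ck_on_comp_linear (W : normedModType R) k (D : set E) (A : {linear E -> E}) (G : E -> W) :
  (forall x, D x -> D (A x)) -> Ck_on k D G -> Ck_on k D (fun x => G (A x)).
Proof.
move=> DA; elim: k G => [|k IH] G [cG dG].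
  split=> [x Dx|//]; apply: (@continuous_comp _ _ _ A G); first exact: continuous_linear_col.
  by apply: cG; exact: DA.
split=> [x Dx|v].
  apply: (@continuous_comp _ _ _ A G); first exact: continuous_linear_col.
  by apply: cG; exact: DA.
have [dGv CGv] := dG (A v); split=> [x Dx|].
  by rewrite /derivable derive_comp_linear; apply: dGv; exact: DA.
suff -> : 'D_v (fun x => G (A x)) = fun x => 'D_(A v) G (A x) by exact: (IH ('D_(A v) G) CGv).
by apply/funext => x; exact: derive_linear_comp.
Qed.

Lemma unitary_inv s : s \is unitarymx -> invmx s \is unitarymx.
Proof. by move=> us; rewrite (invmx_unitary us) trmxC_unitary. Qed.

Lemma actK s : s \is unitarymx -> cancel (act s) (@act R n (invmx s)).
Proof. by move=> us u; rewrite actM mulVmx ?unitarymx_unit // act1. Qed.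

Lemma actKV s : s \is unitarymx -> cancel (@act R n (invmx s)) (act s).
Proof. by move=> us u; rewrite actM mulmxV ?unitarymx_unit // act1. Qed.

Lemma act_sphereK s : s \is unitarymx ->
  cancel (act_sphere s) (@act_sphere R n (invmx s)).
Proof.
move=> us p; apply: val_inj.
by rewrite val_act_sphere ?unitary_inv // val_act_sphere // actK.
Qed.

Lemma act_neq0 s u : s \is unitarymx -> u != 0 -> act s u != 0.
Proof. by move=> us; rewrite -!dot_gt0 dot_act. Qed.

Lemma radial_act s x : s \is unitarymx -> x != 0 ->
  radial (act s x) = act_sphere s (radial x).
Proof.
move=> us x0; apply: val_inj; rewrite val_act_sphere // !radialE ?act_neq0 //.
by rewrite actZ /invnorm /enorm dot_act.
Qed.

Lemma extend_act (W : Type) (f : S -> W) s x : s \is unitarymx -> x != 0 ->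
  extend (fun p => f (act_sphere s p)) x = extend f (act s x).
Proof. by move=> us x0; rewrite /extend radial_act. Qed.

Lemma smooth_act (W : normedModType R) (f : S -> W) s : s \is unitarymx ->
  smooth f -> smooth (fun p => f (act_sphere s p)).
Proof.
move=> us sf k; apply: (Ck_on_congr (F := fun x => extend f (act s x)) oU).
  by move=> x x0; rewrite extend_act.
by apply: Ck_on_comp_linear (sf k) => x /=; exact: act_neq0.
Qed.

Lemma vf_tau s X : s \is unitarymx -> vector_field X -> vector_field (tau s X).
Proof.
move=> us vX; have ut := unitary_inv us; apply: vector_fieldP => [|p].
  exact: smooth_linear (smooth_act ut (vf_smooth vX)).
rewrite /tau -{1}(actKV us (val p)) -val_act_sphere //.
by rewrite dot_act // vf_dot.
Qed.

Lemma along_tau s X Y p : s \is unitarymx -> smooth Y ->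
  along (tau s X) (tau s Y) p = act s (along X Y (act_sphere (invmx s) p)).
Proof.
move=> us sY; have ut := unitary_inv us; have p0 := val_neq0 p.
apply: etrans (along_linear (act s) (tau s X) p (smooth_act ut sY)) _.
congr (act s _); rewrite /along.
rewrite (near_eq_derive (g := fun x => extend Y (act (invmx s) x))); last first.
  by apply: near_open_eq oU _ p0 => x x0; rewrite extend_act.
have e1 : act (invmx s) (tau s X p) = X (act_sphere (invmx s) p) := actK us _.
have e2 := esym (val_act_sphere p ut).
apply: etrans (derive_linear_comp (act (invmx s)) (extend Y) (val p) (tau s X p)) _.
exact: (f_equal2 (fun v x => 'D_v (extend Y) x) e1 e2).
Qed.

Lemma sasaki_tau r s X Y : s \is unitarymx -> vector_field X -> vector_field Y ->
  tau s (sasaki_connection r X Y) = sasaki_connection r (tau s X) (tau s Y).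
Proof.
move=> us vX vY; have ut := unitary_inv us; apply/funext => p.
have e2 : act s (val (act_sphere (invmx s) p)) = val p by rewrite val_act_sphere // actKV.
have C : act s (cform herm r (val (act_sphere (invmx s) p))
    (X (act_sphere (invmx s) p)) (Y (act_sphere (invmx s) p))) =
    cform herm r (val p) (tau s X p) (tau s Y p).
  rewrite -[in RHS]e2; apply: (cform_isometry (H := herm)) => [u v|a u|u|u v].
  - exact: actD.
  - exact: actZ.
  - exact: act_mul_i.
  - exact: dot_act.
apply: etrans (actD s _ _) _.
exact: (f_equal2 +%R (esym (along_tau X p us (vf_smooth vY))) C).
Qed.

Lemma agree_invariant (N N' : connection R n) : agree N N' ->
  is_invariant N' -> is_invariant N.
Proof.
move=> NN' inv s X Y su vX vY; have [us _] := su.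
rewrite NN' // (inv s X Y su vX vY) NN' //; exact: vf_tau.
Qed.

Lemma sasaki_invariant r : is_invariant (sasaki_connection r : connection R n).
Proof. by move=> s X Y [us _]; exact: sasaki_tau. Qed.

End Invariance.

(** * The special unitary group on the standard real basis, and its transitivity on the sphere *)

Section SpecialUnitary.
Variables (R : realType) (n : nat).
Local Notation E := (Cspace R n).
Local Notation S := (sphere R n).
Local Notation J := (@mul_i R n).
Implicit Types (u v w x y z : E) (s t : 'M[R[i]]_n.+1) (k l a b c : 'I_n.+1).

Definition rvec k : E := ofC (delta_mx k 0).

Lemma rvecE k : rvec k = delta_mx (lshift n.+1 k) 0.
Proof.
apply: eq_col => i; case: (split_ordP i) => l ->.
  rewrite col_mxEu !mxE (inj_eq (@lshift_inj _ _)) eqxx !andbT.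
  by case: (l == k).
rewrite col_mxEd !mxE eq_rlshift.
by case: (l == k).
Qed.

Lemma mul_i_rvecE k : J (rvec k) = delta_mx (rshift n.+1 k) 0.
Proof.
apply: eq_col => i; rewrite /mul_i ofCK; case: (split_ordP i) => l ->.
  rewrite col_mxEu !mxE eq_lrshift eqxx andbT.
  by case: (l == k); rewrite ?mulr1 ?mulr0.
rewrite col_mxEd !mxE (inj_eq (@rshift_inj _ _)) eqxx !andbT.
by case: (l == k); rewrite ?mulr1 ?mulr0.
Qed.

Lemma dot_rvec k l : dot (rvec k) (rvec l) = (k == l)%:R.
Proof. by rewrite !rvecE dot_delta !mxE (inj_eq (@lshift_inj _ _)) eqxx andbT. Qed.

Lemma dot_rvec_mul_i k l : dot (rvec k) (J (rvec l)) = 0.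
Proof. by rewrite rvecE mul_i_rvecE dot_delta !mxE eq_lrshift. Qed.

Lemma reflmx_rvec c k : act (reflmx _ c) (rvec k) = (if k == c then -1 else 1) *: rvec k.
Proof.
rewrite /act /rvec ofCK reflmx_mul_delta -ofCZ; congr (@ofC R n (_ *: _)).
case: (k == c); last by [].
exact: (esym (rmorphN1 (real_complex R))).
Qed.

Lemma swap_rvec a b k : act (tperm_mx a b) (rvec k) = rvec (tperm a b k).
Proof. by rewrite /act /rvec ofCK swap_mul_delta. Qed.

Lemma SU_transitive (p : S) : (0 < n)%N -> exists2 s, SU s & act s (rvec ord0) = val p.
Proof.
move=> n0; pose z := (toC (val p))^T.
have z1 : (z *m (map_mx Num.conj z^T)) 0 0 = 1.
  transitivity (((map_mx conjc (toC (val p)))^T *m toC (val p)) 0 0).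
    by rewrite !mxE; apply: eq_bigr => j _; rewrite !mxE mulrC.
  by rewrite dot_toC dot_val.
(* [SU_row] prescribes the first row, whereas the image of e_0 is the first column; hence the
   transpose. *)
have [s [us ds rs]] := SU_row n0 z1; exists s^T.
  by split; [rewrite trmx_unitary|rewrite det_tr].
rewrite /act /rvec ofCK -[RHS]toCK; congr (@ofC R n _).
by rewrite -colE -tr_row rs trmxK.
Qed.

End SpecialUnitary.

(** * Invariant 3-forms and rigidity *)

Section InvariantForm.
Variables (R : realType) (n : nat).
Local Notation E := (Cspace R n).
Local Notation J := (@mul_i R n).
Local Notation e0 := (rvec R (ord0 : 'I_n.+1)).
Implicit Types (u v w x y z : E) (s t : 'M[R[i]]_n.+1) (i j k l m : 'I_n.+1) (a b c : bool) (r : R).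

Definition basis_vec a k : E := if a then J (rvec R k) else rvec R k.

Lemma linear_basis0 (f : E -> R) :
  (forall x y, f (x + y) = f x + f y) -> (forall r x, f (r *: x) = r * f x) ->
  (forall a k, f (basis_vec a k) = 0) -> forall x, f x = 0.
Proof.
move=> fD fZ f0 x; have f00 : f 0 = 0 by rewrite -(scale0r (0 : E)) fZ mul0r.
rewrite (col_sum_delta x) (big_morph f fD f00) big1 // => i _; rewrite fZ.
case: (split_ordP i) => k ->.
  by rewrite -rvecE [f _](f0 false) mulr0.
by rewrite -mul_i_rvecE [f _](f0 true) mulr0.
Qed.

Variable form : E -> E -> E -> R.
Hypothesis formD : forall x x' y z, form (x + x') y z = form x y z + form x' y z.
Hypothesis formZ : forall r x y z, form (r *: x) y z = r * form x y z.
Hypothesis form12 : forall x y z, form y x z = - form x y z.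
Hypothesis form23 : forall x y z, form x z y = - form x y z.
Hypothesis form_e0 : forall y z, form e0 y z = 0.
Hypothesis form_inv : forall s x y z, SU s -> act s e0 = e0 ->
  form (act s x) (act s y) (act s z) = form x y z.
Hypothesis n4 : (4 <= n)%N.
Variable k1 : 'I_n.+1.
Hypothesis k10 : k1 != ord0.
Hypothesis form_k1 : form (J e0) (rvec R k1) (J (rvec R k1)) = 0.

Lemma formZ2 r x y z : form x (r *: y) z = r * form x y z.
Proof. by rewrite form12 formZ -mulrN -form12. Qed.

Lemma formZ3 r x y z : form x y (r *: z) = r * form x y z.
Proof. by rewrite form23 formZ2 -mulrN -form23. Qed.

Lemma self_opp0 r : r = - r -> r = 0. Proof. by lra. Qed.

Lemma form_self12 x z : form x x z = 0.
Proof. exact/self_opp0/form12. Qed.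

Lemma form_self23 x y : form x y y = 0.
Proof. exact/self_opp0/form23. Qed.

Lemma form_self13 x y : form x y x = 0.
Proof. by rewrite form12 form_self23 oppr0. Qed.

Definition sgn m k : R := if k == m then -1 else 1.

Lemma reflmx_basis m a k : act (reflmx R[i] m) (basis_vec a k) = sgn m k *: basis_vec a k.
Proof.
case: a; rewrite /basis_vec ?act_mul_i reflmx_rvec //.
by rewrite mul_iZ.
Qed.

Lemma form_flip m m' a b c i j k : m != ord0 -> m' != ord0 ->
  form (basis_vec a i) (basis_vec b j) (basis_vec c k) =
  (sgn m i * sgn m j * sgn m k) * (sgn m' i * sgn m' j * sgn m' k) *
  form (basis_vec a i) (basis_vec b j) (basis_vec c k).
Proof.
move=> m0 m0'.
have su : SU (reflmx R[i] m *m reflmx R[i] m').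
  by apply: SU_mul; rewrite ?reflmx_unitary ?det_reflmx.
have fix0 : act (reflmx R[i] m *m reflmx R[i] m') e0 = e0.
  rewrite -actM !reflmx_rvec eq_sym (negbTE m0') scale1r reflmx_rvec.
  by rewrite eq_sym (negbTE m0) scale1r.
rewrite -{1}(form_inv _ _ _ su fix0) -!actM !reflmx_basis !actZ !reflmx_basis.
by rewrite !(formZ, formZ2, formZ3); ring.
Qed.

(** Pigeonhole: [ord0] has to be avoided along with [i], [j], [k], and four values cannot exhaust n
    + 1 >= 5 indices. *)
Lemma spare_index i j k : exists2 m, m != ord0 & [/\ m != i, m != j & m != k].
Proof.
pose A := [:: ord0; i; j; k].
have [/existsP[m mA]|/negP mA] := boolP [exists m, m \notin A].
  move: mA; rewrite !inE !negb_or => /and4P[m0 mi mj mk].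
  by exists m.
have : (#|'I_n.+1| <= size A)%N.
  apply: leq_trans (card_size A); apply: subset_leq_card; apply/fintype.subsetP => m _.
  by apply/negPn/negP => mN; apply: mA; apply/existsP; exists m.
by rewrite card_ord /= ltnNge n4.
Qed.

(** The index [m] occurs an odd number of times and reverses the sign; the spare reflection brings
    the determinant back to 1 without touching the three vectors. *)
Lemma form_odd a b c i j k m : m != ord0 ->
  sgn m i * sgn m j * sgn m k = -1 ->
  form (basis_vec a i) (basis_vec b j) (basis_vec c k) = 0.
Proof.
move=> m0 sm; have [m' m0' [mi mj mk]] := spare_index i j k.
have := form_flip a b c i j k m0 m0'.
rewrite sm /sgn ![_ == m']eq_sym (negbTE mi) (negbTE mj) (negbTE mk) !mulr1 mulN1r.
exact: self_opp0.
Qed.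

Lemma form_hopf a b k : k != ord0 ->
  form (J e0) (basis_vec a k) (basis_vec b k) = 0.
Proof.
move=> k0.
have H : form (J e0) (rvec R k) (J (rvec R k)) = 0.
  have [->//|kk1] := eqVneq k k1.
  (* The transposition has determinant -1 and is paired with the reflection at [k1], whose signs on
     e_{k1} and i e_{k1} cancel in the form. *)
  have su : SU ((tperm_mx k1 k : 'M[R[i]]_n.+1) *m reflmx R[i] k1).
    by apply: SU_mul; rewrite ?reflmx_unitary ?det_reflmx ?swap_unitary ?det_swap // eq_sym.
  have fix0 : act ((tperm_mx k1 k : 'M[R[i]]_n.+1) *m reflmx R[i] k1) e0 = e0.
    by rewrite -actM reflmx_rvec eq_sym (negbTE k10) scale1r swap_rvec tpermD.
  have := form_inv (J e0) (rvec R k1) (J (rvec R k1)) su fix0.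
  rewrite form_k1 !act_mul_i fix0 -!actM reflmx_rvec eqxx !actZ mul_iZ swap_rvec tpermL.
  by rewrite formZ2 formZ3 !mulN1r opprK.
case: a b => [] [] //=; rewrite /basis_vec; try exact: form_self23.
by rewrite form23 H oppr0.
Qed.

Lemma form_basis_pair a b c i k : i != k ->
  form (basis_vec a i) (basis_vec b i) (basis_vec c k) = 0.
Proof.
move=> ik; have [k0|k0] := eqVneq k ord0; last first.
  by apply: (form_odd a b c k0); rewrite /sgn eqxx (negbTE ik) !mul1r.
have i0 : i != ord0 by rewrite -k0.
rewrite form23 form12 opprK k0; case: c; first exact: form_hopf.
exact: form_e0.
Qed.

(** Parity count: [form_odd] kills any component with a nonzero index of odd multiplicity. What
    remains is index 0 three times, where e_0 occurs or an argument repeats, or index 0 once beside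
    a repeated nonzero index, where the vector of index 0 is e_0 or i e_0. *)
Lemma form_basis0 a b c i j k :
  form (basis_vec a i) (basis_vec b j) (basis_vec c k) = 0.
Proof.
have [<-|ij] := eqVneq i j.
  have [<-|ik] := eqVneq i k; last exact: form_basis_pair.
  have [->|i0] := eqVneq i ord0; last first.
    by apply: (form_odd a b c i0); rewrite /sgn eqxx mulrNN mulr1 mul1r.
  case: a; last exact: form_e0.
  by case: b c => [] []; rewrite ?form_self12 ?form_self13 ?form_self23.
have [<-|ik] := eqVneq i k.
  by rewrite form23 form_basis_pair ?oppr0.
have [<-|jk] := eqVneq j k.
  by rewrite form12 form23 opprK form_basis_pair // eq_sym.
have [i0|i0] := eqVneq i ord0; last first.
  by apply: (form_odd a b c i0); rewrite /sgn eqxx ![_ == i]eq_sym (negbTE ij) (negbTE ik) !mulr1.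
have j0 : j != ord0 by rewrite -i0 eq_sym.
apply: (form_odd a b c j0).
by rewrite /sgn eqxx (negbTE ij) eq_sym (negbTE jk) mul1r mulr1.
Qed.

Lemma form0 x y z : form x y z = 0.
Proof.
have fD2 x' y1 y2 z' : form x' (y1 + y2) z' = form x' y1 z' + form x' y2 z'.
  by rewrite form12 formD opprD -!form12.
have fD3 x' y' z1 z2 : form x' y' (z1 + z2) = form x' y' z1 + form x' y' z2.
  by rewrite form23 fD2 opprD -!form23.
apply: (linear_basis0 (f := fun v => form v y z)) => // a i.
apply: (linear_basis0 (f := fun v => form (basis_vec a i) v z)) => // [r v|b j].
  exact: formZ2.
apply: (linear_basis0 (f := fun v => form (basis_vec a i) (basis_vec b j) v)) => // [r v|c k].
  exact: formZ3.
exact: form_basis0.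
Qed.

End InvariantForm.

(** * The difference of two invariant connections as an invariant 3-form *)

Section Rigidity.
Variables (R : realType) (n : nat).
Local Notation E := (Cspace R n).
Local Notation S := (sphere R n).
Local Notation F := (sfield R n).
Local Notation J := (@mul_i R n).
Local Notation e0 := (rvec R (ord0 : 'I_n.+1)).
Local Notation p0 := (base_point R n).
Implicit Types (X Y Z : F) (p : S) (u v w x y z : E) (f : S -> R).
Implicit Types (s t : 'M[R[i]]_n.+1).

Lemma val_base_point : val p0 = e0.
Proof. by rewrite rvecE; congr (delta_mx _ _); exact: val_inj. Qed.

Lemma vf_of_add u v : vf_of (u + v) = addf (@vf_of R n u) (vf_of v).
Proof. by apply/funext => p; rewrite /vf_of /addf dotDl scalerDl opprD addrACA. Qed.

Lemma vf_of_scale (c : R) v : vf_of (c *: v) = scalef (fun=> c) (@vf_of R n v).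
Proof. by apply/funext => p; rewrite /vf_of /scalef dotZl -scalerA -scalerBr. Qed.

Lemma tau_vf_of s v : s \is unitarymx -> tau s (vf_of v) = @vf_of R n (act s v).
Proof.
move=> us; have ut := unitary_inv us; apply/funext => p.
rewrite /tau /vf_of actD actN actZ val_act_sphere // actKV //.
have -> // : dot (act s v) (val p) = dot v (act (invmx s) (val p)).
by rewrite -{1}(actKV us (val p)) dot_act.
Qed.

Section Tensor.
Variables (p : S) (T : F -> R).
Hypothesis TD : forall X Y, vector_field X -> vector_field Y -> T (addf X Y) = T X + T Y.
Hypothesis TZ : forall f X, smooth_fun f -> vector_field X -> T (scalef f X) = f p * T X.

(* A field is a combination, with its coordinates as coefficients, of the
   projections of the coordinate fields; this makes [T] a tensor. *)
Lemma tensor_expand X : vector_field X ->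
  T X = \sum_i X p i 0 * T (vf_of (delta_mx i 0)).
Proof.
move=> vX; have sX i : smooth_fun (fun q => X q i 0) by apply: smooth_fun_col; case: vX.
pose P (l : seq 'I_(n.+1 + n.+1)) : F :=
  fun q => \sum_(i <- l) X q i 0 *: @vf_of R n (delta_mx i 0) q.
have XP : X = P (index_enum _).
  apply/funext => q; rewrite /P /vf_of.
  under eq_bigr do rewrite scalerBr scalerA -dotZl.
  by rewrite sumrB -scaler_suml -dot_suml -col_sum_delta vf_dotr // scale0r subr0.
have PS l : vector_field (P l) /\ T (P l) = \sum_(i <- l) X p i 0 * T (vf_of (delta_mx i 0)).
  elim: l => [|i l [vP TP]].
    have -> : P [::] = scalef (fun=> 0) (@vf_of R n 0).
      by apply/funext => q; rewrite /P /scalef big_nil scale0r.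
    have s0 := smooth_fun_cst n (0 : R); have v0 := @vf_vf_of R n 0.
    by split; [exact: vf_scale|rewrite big_nil TZ // mul0r].
  have -> : P (i :: l) = addf (scalef (fun q => X q i 0) (vf_of (delta_mx i 0))) (P l).
    by apply/funext => q; rewrite /P big_cons.
  have vi := vf_scale (sX i) (@vf_vf_of R n (delta_mx i 0)).
  split; first exact: vf_add.
  by rewrite TD // TP big_cons TZ //; exact: vf_vf_of.
by rewrite {1}XP; have [_ ->] := PS (index_enum _).
Qed.

Lemma tensor_local X Y : vector_field X -> vector_field Y -> X p = Y p -> T X = T Y.
Proof. by move=> vX vY XY; rewrite !tensor_expand // XY. Qed.

Lemma tensor0 X : vector_field X -> X p = 0 -> T X = 0.
Proof.
by move=> vX X0; rewrite tensor_expand // big1 // => i _; rewrite X0 mxE mul0r.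
Qed.

End Tensor.

Section Pair.
Variables N N' : connection R n.
Hypotheses (c : is_connection N) (c' : is_connection N').
Hypotheses (g : is_metric N) (g' : is_metric N').
Hypotheses (t : has_skew_torsion N) (t' : has_skew_torsion N').
Hypotheses (inv : is_invariant N) (inv' : is_invariant N').
Local Notation D := (cdiff N N').

Lemma subf_addf X X' Y Y' : subf (addf X X') (addf Y Y') = addf (subf X Y) (subf X' Y').
Proof. by apply/funext => p; rewrite /subf /addf opprD addrACA. Qed.

Lemma subf_scalef f X Y : subf (scalef f X) (scalef f Y) = scalef f (subf X Y).
Proof. by apply/funext => p; rewrite /subf /scalef scalerBr. Qed.

Lemma diffDl X X' Y : vector_field X -> vector_field X' -> vector_field Y ->
  D (addf X X') Y = addf (D X Y) (D X' Y).
Proof.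
case: c c' => _ cD _ _ _ [_ cD' _ _ _] vX vX' vY.
by rewrite /cdiff cD // cD' // subf_addf.
Qed.

Lemma diffZl f X Y : smooth_fun f -> vector_field X -> vector_field Y ->
  D (scalef f X) Y = scalef f (D X Y).
Proof.
case: c c' => _ _ cZ _ _ [_ _ cZ' _ _] sf vX vY.
by rewrite /cdiff cZ // cZ' // subf_scalef.
Qed.

Lemma diffDr X Y Y' : vector_field X -> vector_field Y -> vector_field Y' ->
  D X (addf Y Y') = addf (D X Y) (D X Y').
Proof.
case: c c' => _ _ _ cD _ [_ _ _ cD' _] vX vY vY'.
by rewrite /cdiff cD // cD' // subf_addf.
Qed.

Lemma diffZr f X Y : smooth_fun f -> vector_field X -> vector_field Y ->
  D X (scalef f Y) = scalef f (D X Y).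
Proof.
case: c c' => _ _ _ _ cZ [_ _ _ _ cZ'] sf vX vY.
rewrite /cdiff cZ // cZ' // -subf_scalef; apply/funext => p.
by rewrite /subf /addf opprD addrACA subrr add0r.
Qed.

Lemma diff_tau s X Y : SU s -> vector_field X -> vector_field Y ->
  D (tau s X) (tau s Y) = tau s (D X Y).
Proof.
move=> su vX vY; rewrite /cdiff -(inv su vX vY) -(inv' su vX vY).
by apply/funext => p; rewrite /subf /tau actD actN.
Qed.

(** Passing through [vf_of] makes the form trilinear on all of C^{n+1}, dependent on tangential
    parts only. The third argument needs no projection because the difference field is tangent. *)
Definition dform p x y z : R := dot (D (vf_of x) (vf_of y) p) z.

Lemma metric_dform X Y Z p : vector_field X -> vector_field Y ->
  metric (D X Y) Z p = dform p (X p) (Y p) (Z p).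
Proof.
move=> vX vY; have vx := @vf_vf_of R n (X p); have vy := @vf_vf_of R n (Y p).
have xX : X p = vf_of (X p) p by rewrite vf_of_id // tangentE vf_dot.
have yY : Y p = vf_of (Y p) p by rewrite vf_of_id // tangentE vf_dot.
transitivity (metric (D (vf_of (X p)) Y) Z p).
  apply: (tensor_local (p := p) (T := fun X' => metric (D X' Y) Z p)) => //.
  - by move=> X1 X2 v1 v2; rewrite diffDl // /metric dotDl.
  - by move=> f X1 sf v1; rewrite diffZl // /metric dotZl.
apply: (tensor_local (p := p) (T := fun Y' => metric (D _ Y') Z p)) => //.
- by move=> X1 X2 v1 v2; rewrite diffDr // /metric dotDl.
- by move=> f X1 sf v1; rewrite diffZr // /metric dotZl.
Qed.

Lemma dform_vf p x y z : dform p x y z = metric (D (vf_of x) (vf_of y)) (vf_of z) p.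
Proof.
have vD := vf_cdiff c c' (@vf_vf_of R n x) (@vf_vf_of R n y).
by rewrite /dform /metric dotDr dotNr dotZr vf_dotr // mulr0 subr0.
Qed.

Lemma diff_skew23 X Y Z p : vector_field X -> vector_field Y -> vector_field Z ->
  metric (D X Z) Y p = - metric (D X Y) Z p.
Proof. exact: cdiff_skew. Qed.

(** Antisymmetrising the difference gives the difference of the torsions, which is skew in its last
    two arguments. The difference itself has that skewness by metricity, so the term with its first
    two arguments exchanged inherits it; in these variables that is skewness in arguments 1 and
    3. *)
Lemma diff_exchange X Y Z p : vector_field X -> vector_field Y -> vector_field Z ->
  metric (D Z X) Y p = - metric (D Y X) Z p.
Proof.
move=> vX vY vZ; have [_ _ _ _ tS] := t; have [_ _ _ _ tS'] := t'.
have W A B C : metric (D A B) C p - metric (D B A) C p =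
    metric (torsion N A B) C p - metric (torsion N' A B) C p.
  have B2 (u v w : E) : dot (u - v) w = dot u w - dot v w by rewrite dotDl dotNl.
  apply: etrans (esym (B2 _ _ _)) (etrans _ (B2 _ _ _)).
  apply: (congr1 (fun v : E => dot v (C p))); exact: cdiff_torsion.
have K (a b a' b' w1 w2 w1' w2' : R) : a - b = w1 - w2 -> a' - b' = w1' - w2' ->
    w1' = - w1 -> w2' = - w2 -> a' = - a -> b' = - b by lra.
exact: (K _ _ _ _ _ _ _ _ (W X Y Z) (W X Z Y) (tS X Y Z vX vY vZ p)
  (tS' X Y Z vX vY vZ p) (diff_skew23 p vX vY vZ)).
Qed.

(** The transposition (12) is (23)(13)(23), three sign changes. *)
Lemma diff_skew12 X Y Z p : vector_field X -> vector_field Y -> vector_field Z ->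
  metric (D Y X) Z p = - metric (D X Y) Z p.
Proof.
move=> vX vY vZ; have K (a b d e : R) : b = - d -> d = - e -> e = - a -> b = - a by lra.
exact: (K _ _ _ _ (diff_skew23 p vY vZ vX) (diff_exchange p vZ vX vY)
  (diff_skew23 p vX vY vZ)).
Qed.

Lemma dformD p x x' y z : dform p (x + x') y z = dform p x y z + dform p x' y z.
Proof. by rewrite /dform vf_of_add diffDl ?dotDl //; exact: vf_vf_of. Qed.

Lemma dformZ p (r : R) x y z : dform p (r *: x) y z = r * dform p x y z.
Proof.
rewrite /dform vf_of_scale diffZl ?dotZl //; try exact: vf_vf_of.
exact: smooth_fun_cst.
Qed.

Lemma dform12 p x y z : dform p y x z = - dform p x y z.
Proof. by rewrite !dform_vf diff_skew12 //; exact: vf_vf_of. Qed.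

Lemma dform23 p x y z : dform p x z y = - dform p x y z.
Proof. by rewrite !dform_vf diff_skew23 //; exact: vf_vf_of. Qed.

Lemma dform_val p y z : dform p (val p) y z = 0.
Proof.
rewrite dform_vf; have vy := @vf_vf_of R n y; have vp := @vf_vf_of R n (val p).
apply: (tensor0 (p := p) (T := fun X => metric (D X (vf_of y)) (vf_of z) p)) => //.
- by move=> X1 X2 v1 v2; rewrite diffDl // /metric dotDl.
- by move=> f X1 sf v1; rewrite diffZl // /metric dotZl.
- by rewrite /vf_of dot_val scale1r subrr.
Qed.

Lemma dform_act p s x y z : SU s ->
  dform (act_sphere s p) (act s x) (act s y) (act s z) = dform p x y z.
Proof.
move=> su; have [us _] := su.
rewrite /dform -!tau_vf_of // diff_tau //; try exact: vf_vf_of.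
by rewrite /tau act_sphereK // dot_act.
Qed.

Lemma agree_of_dform k1 : (4 <= n)%N -> k1 != ord0 ->
  dform p0 (J e0) (rvec R k1) (J (rvec R k1)) = 0 -> agree N N'.
Proof.
move=> n4 k10 h.
have base x y z : dform p0 x y z = 0.
  apply: (form0 (form := dform p0) _ _ _ _ _ _ n4 k10 h).
  - exact: dformD.
  - exact: dformZ.
  - exact: dform12.
  - exact: dform23.
  - by move=> y' z'; rewrite -val_base_point dform_val.
  - move=> s x' y' z' su fix0; rewrite -(dform_act p0 x' y' z' su); congr dform.
    by apply: val_inj; rewrite val_act_sphere; [rewrite val_base_point|case: su].
(* Invariance carries the vanishing at the base point to any point reached by transitivity. *)
have all p x y z : dform p x y z = 0.
  have [s su sp] := SU_transitive p (ltn_trans (isT : 0 < 3)%N n4).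
  have [us _] := su.
  have -> : p = act_sphere s p0 by apply: val_inj; rewrite val_act_sphere // val_base_point.
  by rewrite -(actKV us x) -(actKV us y) -(actKV us z) dform_act.
move=> X Y vX vY; apply/funext => p; apply/eqP; rewrite -subr_eq0 -dot_eq0.
exact/eqP/(etrans (metric_dform (D X Y) p vX vY))/all.
Qed.

End Pair.
End Rigidity.

(** * The invariant connections and the Einstein condition at the base point *)

Section Classification.
Variables (R : realType) (n : nat).
Hypothesis n4 : (4 <= n)%N.
Local Notation E := (Cspace R n).
Local Notation J := (@mul_i R n).
Local Notation herm := (cspace_hermitian R n).
Local Notation p0 := (base_point R n).
Local Notation k1 := (inord 1 : 'I_n.+1).
Local Notation e0 := (rvec R (ord0 : 'I_n.+1)).
Local Notation e1 := (rvec R k1).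
Implicit Types (N : connection R n) (r : R).

Let k10 : k1 != ord0.
Proof. by rewrite -val_eqE /= inordK // ltnS; exact: leq_trans n4. Qed.

Let e1e0 : dot e1 e0 = 0.
Proof. by rewrite dot_rvec (negbTE k10). Qed.

Let e1_tangent : e1 \in tangent p0.
Proof. by rewrite tangentE dotC val_base_point e1e0. Qed.

Let Je0_tangent : J e0 \in tangent p0.
Proof. by rewrite tangentE val_base_point dot_rvec_mul_i. Qed.

Lemma sasaki_classification N : is_connection N -> is_invariant N ->
  is_metric N -> has_skew_torsion N -> exists r, agree N (sasaki_connection r).
Proof.
move=> c inv g t; pose U := @vf_of R n (J e0); pose V := @vf_of R n e1.
(* The component on (i e_0, e_1, i e_1) relative to the flat derivative. The Levi-Civita term of
   [cform] is normal and does not contribute, so by [cform_hopf] the model with this [r] has the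
   same component. *)
pose r := dot (N U V p0 - along U V p0) (J e1); exists r.
apply: (agree_of_dform c (@sasaki_is_connection R n r) g (@sasaki_is_metric R n r)
  t (@sasaki_has_skew_torsion R n r) inv (@sasaki_invariant R n r) n4 k10).
have hopf : dot (cform herm r (val p0) (U p0) (V p0)) (J e1) = r.
  rewrite /U /V !vf_of_id // val_base_point.
  apply: (cform_hopf (H := herm)).
  - by rewrite [LHS]dot_rvec eqxx.
  - by rewrite [LHS]dot_rvec eqxx.
  - by rewrite [LHS]dotC.
  - exact: dot_rvec_mul_i.
have K (a b w z : E) : dot (a - (b + w)) z = dot (a - b) z - dot w z.
  by rewrite opprD addrA (dotDl (a - b) (- w)) (dotNl w).
by apply: etrans (K _ _ _ _) _; rewrite hopf subrr.
Qed.

(** At the base point the two test fields are -xi and a unit vector annihilated by eta. Both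
    equations have right side [s], while their left sides differ by 2 (n - 1) r^2. *)
Lemma sasaki_einstein r (s : R) :
  (forall X Y, vector_field X -> vector_field Y ->
     Sym (ricci (sasaki_connection r)) X Y p0 = s * metric X Y p0) -> r = 0.
Proof.
move=> Ein; have vU := @vf_vf_of R n (J e0); have vV := @vf_vf_of R n e1.
have := Ein _ _ vV vV; have := Ein _ _ vU vU; rewrite /Sym !sasaki_ricci //.
have -> : metric (@vf_of R n (J e0)) (vf_of (J e0)) p0 = 1.
  by rewrite /metric vf_of_id // dot_mul_i dot_rvec eqxx.
have -> : metric (@vf_of R n e1) (vf_of e1) p0 = 1.
  by rewrite /metric vf_of_id // dot_rvec eqxx.
have -> : eta (@vf_of R n (J e0)) p0 = - 1.
  by rewrite /eta vf_of_id // mul_iK val_base_point dotNl dot_rvec eqxx.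
have -> : eta (@vf_of R n e1) p0 = 0.
  by rewrite /eta vf_of_id // val_base_point dotC dot_rvec_mul_i.
move=> E1 E2; have : (n%:R - 1) * r ^+ 2 = 0 by lra.
move/eqP; rewrite mulf_eq0 sqrf_eq0 subr_eq0 (eqr_nat R n 1).
by case/orP => /eqP // n1; move: n4; rewrite n1.
Qed.

End Classification.

Theorem corollary4p12 (R : realType) (n : nat) (hn : (4 <= n)%N)
  (nablag : connection R n) (hg : is_levi_civita nablag) :
  (forall r : R,
     let nabla := nabla_r nablag r in
     [/\ [/\ is_connection nabla, is_invariant nabla, is_metric nabla &
             has_skew_torsion nabla],
         forall X Y, vector_field X -> vector_field Y ->
           forall p, Sym (ricci nabla) X Y p =
             2 * (n%:R - r ^+ 2) * metric X Y p
             - 2 * (n%:R - 1) * r ^+ 2 * (eta X p * eta Y p) &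
         forall p, scalar_curvature nabla p =
           2 * n%:R * (2 * n%:R + 1) - 6 * n%:R * r ^+ 2]) /\
  (forall nabla : connection R n,
     is_connection nabla -> is_invariant nabla -> is_metric nabla ->
     is_einstein nabla ->
     forall X Y, vector_field X -> vector_field Y ->
       nabla X Y = nablag X Y).
Proof.
split=> [r nabla|nabla c inv g [_ t Ein] X Y vX vY].
  have A : agree nabla (sasaki_connection r) := nabla_r_agree r hg.
  have cr := @sasaki_is_connection R n r; split; first split.
  - exact: agree_connection A cr.
  - exact: agree_invariant A (@sasaki_invariant R n r).
  - exact: agree_metric A (@sasaki_is_metric R n r).
  - exact: agree_skew_torsion A (@sasaki_has_skew_torsion R n r).
  - move=> X Y vX vY p; rewrite /Sym !(agree_ricci A) // !sasaki_ricci //.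
    have -> : metric Y X p = metric X Y p by exact: dotC.
    by rewrite [eta Y p * _]mulrC; lra.
  - by move=> p; rewrite (agree_scalar A) // sasaki_scalar.
have [r A] := sasaki_classification hn c inv g t.
have cr := @sasaki_is_connection R n r.
have r0 : r = 0.
  apply: (sasaki_einstein (s := scalar_curvature nabla (base_point R n) / (2 * n + 1)%:R) hn).
  by move=> X' Y' vX' vY'; rewrite -(Ein _ _ vX' vY') /Sym !(agree_ricci A).
(* Both connections now equal [sasaki_connection 0]: [nablag] by uniqueness, [nabla] by the
   classification with [r = 0]. *)
by rewrite (levi_civita_unique hg vX vY) -r0 A.
Qed.
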